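(* Let $s\in S$ and $w\in\mathbf{I}_*$, and let $c_s=u^{-1}(T_s+1)\in\underline{\mathfrak{H}}$. (a) If $sw=ws^*>w$ then $c_sA_w=(v+v^{-1})A_{sw}+\sum_{z\in\mathbf{I}_*;\,sz<z<sw}\mathcal{M}^s_{z,w}A_z$. (b) If $sw\neq ws^*$ and $sw>w$ then $c_sA_w=A_{sws^*}+\sum_{z\in\mathbf{I}_*;\,sz<z<sws^*}\mathcal{M}^s_{z,w}A_z$. (c) If $sw<w$ then $c_sA_w=(u+u^{-1})A_w$.
   Context: $W$ is a Coxeter group with set of simple reflections $S$, length function $l:W\to\mathbf{N}$ and Bruhat order $\le$; $\epsilon_x=(-1)^{l(x)}$. $w\mapsto w^*$ is an automorphism of $W$ with square $1$ which leaves $S$ stable. $\mathbf{I}_*=\{w\in W : (w^* )^{-1}=w\}$. $\delta_{x,y}$ is $1$ if $x=y$ and $0$ otherwise. $u$ is an indeterminate and $\mathcal{A}=\mathbf{Z}[u,u^{-1}]$. $\mathfrak{H}$ is the free $\mathcal{A}$-module with basis $(T_w)_{w\in W}$ with the unique $\mathcal{A}$-algebra structure with unit $T_1$ such that $T_wT_{w'}=T_{ww'}$ if $l(ww')=l(w)+l(w')$, and $(T_s+1)(T_s-u^2)=0$ for all $s\in S$. $\overline{\phantom{x}}:\mathfrak{H}\to\mathfrak{H}$ is the unique ring involution such that $\overline{u^nT_x}=u^{-n}T_{x^{-1}}^{-1}$ for $x\in W$, $n\in\mathbf{Z}$. $M$ is the free $\mathcal{A}$-module with basis $\{a_w : w\in\mathbf{I}_*\}$,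 with its unique $\mathfrak{H}$-module structure such that for $s\in S$, $w\in\mathbf{I}_*$: $T_s a_w = u a_w + (u+1)a_{sw}$ if $sw = ws^* > w$; $T_s a_w = (u^2-u-1)a_w + (u^2-u)a_{sw}$ if $sw = ws^* < w$; $T_s a_w = a_{sws^*}$ if $sw\ne ws^*$, $sw > w$; $T_s a_w = (u^2-1)a_w + u^2 a_{sws^*}$ if $sw\ne ws^*$, $sw < w$. $\overline{\phantom{x}}:M\to M$ is the unique $\mathbf{Z}$-linear map such that $\overline{hm}=\overline{h}\,\overline{m}$ for $h\in\mathfrak{H}$, $m\in M$ and $\overline{a_1}=a_1$. $v$ is an indeterminate, $\underline{\mathcal{A}}=\mathbf{Z}[v,v^{-1}]\supset\mathcal{A}$ via $u=v^2$. $\underline{\mathfrak{H}}=\underline{\mathcal{A}}\otimes_{\mathcal{A}}\mathfrak{H}$ acts $\underline{\mathcal{A}}$-linearly on $\underline{M}=\underline{\mathcal{A}}\otimes_{\mathcal{A}}M$, and $\overline{\phantom{x}}$ is extended to $\underline{M}$ by $\overline{v^nm}=v^{-n}\overline{m}$ for $m\in M$, $n\in\mathbf{Z}$. For $w\in\mathbf{I}_*$, $A_w=v^{-l(w)}\sum_{y\in\mathbf{I}_*;\,y\le w}P^\sigma_{y,w}a_y\in\underline{M}$ (with $P^\sigma_{y,w}\in\mathbf{Z}[u]$) is the unique element of this form such that $\overline{A_w}=A_w$, $P^\sigma_{w,w}=1$ and $\deg P^\sigma_{y,w}\le(l(w)-l(y)-1)/2$ for all $y\in\mathbf{I}_*$,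 $y<w$. For $y,w\in\mathbf{I}_*$ set $\pi_{y,w}=v^{-l(w)+l(y)}P^\sigma_{y,w}$ if $y\le w$ and $\pi_{y,w}=0$ if $y\not\le w$; thus $\pi_{w,w}=1$ and $\pi_{y,w}\in v^{-1}\mathbf{Z}[v^{-1}]$ for $y\ne w$. Define integers $\mu'_{y,w},\mu''_{y,w}$ by $$\pi_{y,w}\equiv\delta_{y,w}+\mu'_{y,w}v^{-1}+\mu''_{y,w}v^{-2}\mod v^{-3}\mathbf{Z}[v^{-1}].$$ For $s\in S$ and $y,w\in\mathbf{I}_*$ with $sy<y$ and $sw>w$, define $\mathcal{M}^s_{y,w}\in\underline{\mathcal{A}}$ by $$\mathcal{M}^s_{y,w}=\mu''_{y,w}-\sum_{x\in\mathbf{I}_*;\,y<x<w,\,sx<x}\mu'_{y,x}\mu'_{x,w}-\delta_{sw,ws^*}\mu'_{y,sw}+\mu'_{sy,w}\delta_{sy,ys^*}\quad\text{if }\epsilon_y=\epsilon_w,$$ $$\mathcal{M}^s_{y,w}=\mu'_{y,w}(v+v^{-1})\quad\text{if }\epsilon_y=-\epsilon_w,$$ where a term containing a factor $\delta$ equal to $0$ is understood to be $0$. *)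

(* Defs.v *)
From HB Require Import structures.
From mathcomp Require Import all_boot all_order all_algebra.
From mathcomp Require Import all_classical.

Set Implicit Arguments.
Unset Strict Implicit.
Unset Printing Implicit Defensive.
Import GRing.Theory.
Local Open Scope classical_set_scope.
Local Open Scope ring_scope.

(* [laurent k] is the subring Z[v^k, v^-k] of the field Q(v) (presented as the
   fraction field of Z[v]).  Only k = 1 and k = 2 are used below. *)

Definition funfield : fieldType := {fraction {poly int}}.

Definition tgen (k : nat) : funfield := (tofrac 'X) ^+ k.

Definition laurent_pred (k : nat) : {pred funfield} :=
  [pred x | `[< exists (p : {poly int}) (n : nat),
      x = (map_poly intr p).[tgen k] / tgen k ^+ n >]].

Lemma tgen_neq0 k : tgen k != 0.
Proof. by rewrite expf_neq0 // tofrac_eq0 polyX_eq0. Qed.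

Lemma laurent_subring k : subring_closed (laurent_pred k).
Proof.
have h0 m : tgen k ^+ m != 0 by rewrite expf_neq0 // tgen_neq0.
split.
- apply/asboolP; exists 1, 0; by rewrite expr0 divr1 rmorph1 hornerC.
- move=> x y /asboolP[p [m ->]] /asboolP[q [n ->]]; apply/asboolP.
  exists (p * 'X^n - q * 'X^m), (m + n)%N.
  rewrite rmorphB !rmorphM /= !map_polyXn !hornerE exprD.
  by rewrite -mulNr addf_div // mulNr.
- move=> x y /asboolP[p [m ->]] /asboolP[q [n ->]]; apply/asboolP.
  exists (p * q), (m + n)%N.
  by rewrite rmorphM /= hornerM exprD mulf_div.
Qed.

HB.instance Definition _ k :=
  GRing.isSubringClosed.Build funfield (laurent_pred k) (laurent_subring k).

Record laurent (k : nat) := Laurent {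
  laurent_val :> funfield;
  laurent_valP : laurent_val \in laurent_pred k }.

HB.instance Definition _ k := [isSub for @laurent_val k].
HB.instance Definition _ k := [Choice of laurent k by <:].
HB.instance Definition _ k :=
  [SubChoice_isSubComNzRing of laurent k by <:].

Section LaurentUnits.
Variable k : nat.
Implicit Type x : laurent k.

Definition laurent_unit : pred (laurent k) :=
  [pred x | (val x != 0) && ((val x)^-1 \in laurent_pred k)].

Definition laurent_inv x : laurent k := insubd x (val x)^-1.

Lemma laurent_mulVx : {in laurent_unit, left_inverse 1 laurent_inv *%R}.
Proof.
move=> x /andP[x0 xV]; apply: val_inj.
by rewrite rmorphM rmorph1 /= val_insubd xV mulVf.
Qed.

Lemma laurent_unitPl x y : y * x = 1 -> laurent_unit x.
Proof.
move=> /(congr1 val); rewrite rmorphM rmorph1 /= => yx.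
have x0 : val x != 0.
  by apply: contra_eq_neq yx => ->; rewrite mulr0 eq_sym oner_neq0.
apply/andP; split=> //.
by rewrite -[_^-1]mul1r -yx mulfK // (valP y).
Qed.

Lemma laurent_inv_out : {in [predC laurent_unit], laurent_inv =1 id}.
Proof.
move=> x; rewrite inE /= negb_and negbK => xU; apply: val_inj.
rewrite val_insubd; case: ifP => // xV; move: xU; rewrite xV orbF.
by move/eqP->; rewrite invr0.
Qed.
End LaurentUnits.

HB.instance Definition _ k := GRing.ComNzRing_hasMulInverse.Build (laurent k)
  (@laurent_mulVx k) (@laurent_unitPl k) (@laurent_inv_out k).

Lemma tgen_laurent k : tgen k \in laurent_pred k.
Proof.
by apply/asboolP; exists 'X, 0; rewrite map_polyX hornerX expr0 divr1.
Qed.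

Definition lgen k : laurent k := Laurent (tgen_laurent k).

Lemma lgen_unit k : lgen k \is a GRing.unit.
Proof.
apply/andP; split; first exact: tgen_neq0.
by apply/asboolP; exists 1, 1%N; rewrite rmorph1 hornerC expr1 mul1r.
Qed.

Definition Au := laurent 2.
Definition u : Au := lgen 2.
Definition Av := laurent 1.
Definition v : Av := lgen 1.

Lemma laurent21 (x : Au) : laurent_val x \in laurent_pred 1.
Proof.
case: x => x /= /asboolP[p [n ->]]; apply/asboolP.
exists (p \Po 'X^2), (2 * n)%N.
by rewrite map_comp_poly map_polyXn horner_comp hornerXn /tgen -!exprM !mul1n.
Qed.

Definition inclA (x : Au) : Av := Laurent (laurent21 x).

Lemma incl_is_zmod_morphism : zmod_morphism inclA.
Proof. by move=> x y; apply: val_inj. Qed.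
Lemma incl_is_monoid_morphism : monoid_morphism inclA.
Proof. by split=> [|x y]; apply: val_inj. Qed.
HB.instance Definition _ :=
  GRing.isZmodMorphism.Build Au Av inclA incl_is_zmod_morphism.
HB.instance Definition _ :=
  GRing.isMonoidMorphism.Build Au Av inclA incl_is_monoid_morphism.

Fact incl_u : inclA u = v ^+ 2.
Proof. by apply: val_inj; rewrite rmorphXn /= /tgen expr1. Qed.

Definition zeval (R : comNzRingType) (p : {poly int}) (x : R) : R :=
  (map_poly intr p).[x].

(* [cox_presentation] says that the relations (st)^m(s,t) = 1, with m(s,t) the
   order of st, present the group: it is the existence half of the universal
   property (uniqueness being given by [cox_generated]). *)
Record coxeterSystem := CoxeterSystem {
  cox_group :> groupType;
  simple : set cox_group;
  simple_neq1 : forall s, simple s -> s <> 1%g;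
  simple_sqr : forall s, simple s -> (s * s)%g = 1%g;
  cox_generated : forall w, exists ss : seq cox_group,
    (forall s, s \in ss -> simple s) /\ (\prod_(s <- ss) s)%g = w;
  cox_presentation : forall (G : groupType) (f : cox_group -> G),
    (forall s t n, simple s -> simple t ->
       ((s * t) ^+ n)%g = 1%g -> ((f s * f t) ^+ n)%g = 1%g) ->
    exists phi : {multiplicative cox_group -> G},
      forall s, simple s -> phi s = f s }.

Section Coxeter.
Variable W : coxeterSystem.
Implicit Types (s t w x y : W).

Definition word_length w (n : nat) : bool :=
  `[< exists ss : seq W, [/\ forall s, s \in ss -> simple s,
        (\prod_(s <- ss) s)%g = w & size ss = n] >].

Lemma word_length_ex w : exists n, word_length w n.
Proof.
have [ss [ssS ssw]] := cox_generated w.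
by exists (size ss); apply/asboolP; exists ss.
Qed.

Definition len w : nat := ex_minn (word_length_ex w).

Definition cox_reflection : set W :=
  [set t | exists x s, simple s /\ t = (x * s * x^-1)%g].

Inductive bruhat_le x : W -> Prop :=
| bruhat_refl : bruhat_le x x
| bruhat_step y t : bruhat_le x y -> cox_reflection t ->
    (len y < len (y * t)%g)%N -> bruhat_le x (y * t)%g.

Definition bruhat_lt x y : Prop := bruhat_le x y /\ x <> y.

Record diagramInvolution := DiagramInvolution {
  star :> W -> W;
  star_mul : forall x y, star (x * y)%g = (star x * star y)%g;
  star_invol : involutive star;
  star_simple : forall s, simple s -> simple (star s) }.

Definition Istar (st : diagramInvolution) : set W :=
  [set w | ((st w)^-1)%g = w].

End Coxeter.

Definition is_basis_on (R : nzRingType) (V : lmodType R) (I : choiceType)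
    (D : set I) (b : I -> V) : Prop :=
  (forall x : V, exists (r : seq I) (c : I -> R),
     [/\ uniq r, forall i, i \in r -> D i & x = \sum_(i <- r) c i *: b i]) /\
  (forall (r : seq I) (c : I -> R), uniq r -> (forall i, i \in r -> D i) ->
     \sum_(i <- r) c i *: b i = 0 -> forall i, i \in r -> c i = 0).

Record is_action (R : comNzRingType) (H : algType R) (M : lmodType R)
    (act : H -> M -> M) : Prop := IsAction {
  act_linear_l : forall m, linear (act^~ m);
  act_linear_r : forall h, linear (act h);
  act_one : forall m, act 1 m = m;
  act_mul : forall h h' m, act (h * h') m = act h (act h' m) }.

(* [j : V -> V'] exhibits V' as the tensor product of V with R' over R. *)
Definition is_base_change (R R' : comNzRingType) (f : {rmorphism R -> R'})
    (V : lmodType R) (V' : lmodType R') (j : {linear V -> V' | f \; *:%R}) :=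
  forall (N : lmodType R') (g : {linear V -> N | f \; *:%R}),
    exists2 g' : {linear V' -> N}, (forall x, g' (j x) = g x) &
      forall g'' : {linear V' -> N}, (forall x, g'' (j x) = g x) -> g'' =1 g'.

Record heckeAlgebra (W : coxeterSystem) := HeckeAlgebra {
  hecke_alg :> unitAlgType Au;
  hT : W -> hecke_alg;
  hT_basis : is_basis_on setT hT;
  hT_one : hT 1%g = 1;
  hT_mul : forall w w' : W, len (w * w')%g = (len w + len w')%N ->
    hT w * hT w' = hT (w * w')%g;
  hT_quad : forall s, simple s -> (hT s + 1) * (hT s - (u ^+ 2)%:A) = 0;
  hbar : {rmorphism hecke_alg -> hecke_alg};
  hbar_invol : involutive hbar;
  hbarE : forall (n : int) (x : W),
    hbar (u ^ n *: hT x) = u ^ (- n) *: (hT x^-1%g)^-1 }.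

(* [bruhat_lt w (s * w)] is the Bruhat comparison written sw > w.
   The family [ma] is indexed by all of W; only its values on I_* matter. *)
Record involutionModule (W : coxeterSystem) (st : diagramInvolution W)
    (H : heckeAlgebra W) := InvolutionModule {
  inv_mod :> lmodType Au;
  mact : H -> inv_mod -> inv_mod;
  mactP : is_action mact;
  ma : W -> inv_mod;
  ma_basis : is_basis_on (Istar st) ma;
  mact_comm_up : forall s w, simple s -> Istar st w ->
    (s * w = w * st s)%g -> bruhat_lt w (s * w)%g ->
    mact (hT H s) (ma w) = u *: ma w + (u + 1) *: ma (s * w)%g;
  mact_comm_down : forall s w, simple s -> Istar st w ->
    (s * w = w * st s)%g -> bruhat_lt (s * w)%g w ->
    mact (hT H s) (ma w) =
      (u ^+ 2 - u - 1) *: ma w + (u ^+ 2 - u) *: ma (s * w)%g;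
  mact_ncomm_up : forall s w, simple s -> Istar st w ->
    (s * w)%g <> (w * st s)%g -> bruhat_lt w (s * w)%g ->
    mact (hT H s) (ma w) = ma (s * w * st s)%g;
  mact_ncomm_down : forall s w, simple s -> Istar st w ->
    (s * w)%g <> (w * st s)%g -> bruhat_lt (s * w)%g w ->
    mact (hT H s) (ma w) =
      (u ^+ 2 - 1) *: ma w + (u ^+ 2) *: ma (s * w * st s)%g;
  mbar : {additive inv_mod -> inv_mod};
  mbarM : forall h m, mbar (mact h m) = mact (hbar H h) (mbar m);
  mbar1 : mbar (ma 1%g) = ma 1%g }.

Record heckeExtension (W : coxeterSystem) (H : heckeAlgebra W) :=
  HeckeExtension {
  hecke_ext :> algType Av;
  hj : {lrmorphism H -> hecke_ext | inclA \; *:%R};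
  hj_base_change : is_base_change (f := inclA) hj }.

Record moduleExtension (W : coxeterSystem) (st : diagramInvolution W)
    (H : heckeAlgebra W) (M : involutionModule st H) (HX : heckeExtension H) :=
  ModuleExtension {
  mod_ext :> lmodType Av;
  mj : {linear M -> mod_ext | inclA \; *:%R};
  mj_base_change : is_base_change (f := inclA) mj;
  mxact : HX -> mod_ext -> mod_ext;
  mxactP : is_action mxact;
  mxactE : forall (h : H) (m : M), mxact (hj HX h) (mj m) = mj (mact h m);
  mxbar : {additive mod_ext -> mod_ext};
  mxbarE : forall (n : int) (m : M),
    mxbar (v ^ n *: mj m) = v ^ (- n) *: mj (mbar M m) }.

Section CanonicalBasis.
Variables (W : coxeterSystem) (st : diagramInvolution W) (H : heckeAlgebra W).
Variables (M : involutionModule st H) (HX : heckeExtension H).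
Variable MX : moduleExtension M HX.

Definition Aelt (P : W -> W -> {poly int}) (w : W) : MX :=
  v ^ (- (len w)%:Z) *:
    \sum_(y \in [set y | Istar st y /\ bruhat_le y w])
      inclA (zeval (P y w) u) *: mj MX (ma M y).

(* For y < w one has len y < len w, so the subtractions are not truncated;
   the bound is on an integer, so halving with rounding down is harmless. *)
Record is_Psigma (P : W -> W -> {poly int}) : Prop := IsPsigma {
  Psigma_bar : forall w, Istar st w -> mxbar MX (Aelt P w) = Aelt P w;
  Psigma_diag : forall w, Istar st w -> P w w = 1;
  Psigma_deg : forall y w, Istar st y -> Istar st w -> bruhat_lt y w ->
    ((size (P y w)).-1 <= (len w - len y - 1)./2)%N }.

End CanonicalBasis.

Section MuCoefficients.
Variables (W : coxeterSystem) (st : diagramInvolution W).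
Variable P : W -> W -> {poly int}.

Definition pi_ (y w : W) : Av :=
  if `[< bruhat_le y w >]
  then v ^ (- (len w)%:Z + (len y)%:Z) * inclA (zeval (P y w) u) else 0.

Definition is_mu (mu1 mu2 : W -> W -> int) : Prop :=
  forall y w : W, Istar st y -> Istar st w ->
    exists p : {poly int},
      pi_ y w - ((y == w)%:R + (mu1 y w)%:~R * v ^- 1 + (mu2 y w)%:~R * v ^- 2)
        = v ^- 3 * zeval p v^-1.

Definition epsilon (x : W) : int := (-1) ^+ len x.

(* The function mu1 is total on W, so that a term with a zero factor delta
   vanishes even when its other factor has an index outside I_*. *)
Definition Mcoef (mu1 mu2 : W -> W -> int) (s y w : W) : Av :=
  if epsilon y == epsilon w then
    (mu2 y w
     - \sum_(x \in [set x | [/\ Istar st x, bruhat_lt y x, bruhat_lt x w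
                              & bruhat_lt (s * x)%g x]]) mu1 y x * mu1 x w
     - ((s * w == w * st s)%g)%:R * mu1 y (s * w)%g
     + mu1 (s * y)%g w * ((s * y == y * st s)%g)%:R)%:~R
  else (mu1 y w)%:~R * (v + v^-1).

End MuCoefficients.

Definition c_ (W : coxeterSystem) (H : heckeAlgebra W) (HX : heckeExtension H)
    (s : W) : HX := (inclA u)^-1 *: (hj HX (hT H s) + 1).

(* Main.v *)
(* Write a'_y = v^(-len y) a_y.  On elements of the span of the a'_y, the
   A_w being bar invariant makes the bar involution unitriangular for the
   length; hence a bar invariant element whose coordinates all lie in
   v^-1 Z[v^-1] vanishes (look at a longest y with nonzero coordinate).

   Let s o y be sy if sy = ys^* and sys^* otherwise.  If sw < w, the element
   c_s A_w - (u + u^-1) A_w is bar invariant, and at each y with sy < y its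
   coordinate is a bar invariant nonzero multiple of
   pi_(s o y, w) - v^(-1 or -2) pi_(y, w), which lies in v^-1 Z[v^-1]; so it
   vanishes, which is (c).  If sw > w, the difference of the two sides of (a) or
   (b) is bar invariant and, by (c), again an eigenvector of c_s with eigenvalue
   u + u^-1, so its coordinates at y < s o y are determined by those at s o y;
   the coefficients M^s are precisely what makes the coordinates at y with
   sy < y lie in v^-1 Z[v^-1].

   On the Coxeter side the presentation provides a cocycle
   N(xy)(r) = N(x)(y r y^-1) + N(y)(r) mod 2 with N(s) the indicator of s; for a
   reflection t, N(w)(t) = 1 iff wt < w, from which the exchange and lifting
   properties follow. *)

Require Import Defs.
From HB Require Import structures.
From mathcomp Require Import all_boot all_order all_algebra.
From mathcomp Require Import all_classical.
From mathcomp Require Import finmap zify ring.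
Import GRing.Theory.
Local Open Scope classical_set_scope.
Local Open Scope ring_scope.

Set Implicit Arguments.
Unset Strict Implicit.
Unset Printing Implicit Defensive.

(** * Exchange and Bruhat order from the presentation *)

(** The semidirect product of [W] with the functions from [W] to F_2 ([bool] under [addb]), on which
    [W] acts by conjugating the argument. A homomorphism from [W] that lifts the identity amounts to
    a cocycle mod 2. *)
Definition reflext (W : groupType) : Type := (W * (W -> bool))%type.

Section ReflectionExtension.
Variable W : groupType.
Implicit Types x y : reflext W.

HB.instance Definition _ := Choice.on (reflext W).

Definition reflext_one : reflext W := (1%g, fun=> false).
Definition reflext_mul x y : reflext W :=
  ((x.1 * y.1)%g, fun r => x.2 (y.1 * r * y.1^-1)%g (+) y.2 r).
Definition reflext_inv x : reflext W :=
  ((x.1^-1)%g, fun r => x.2 (x.1^-1 * r * x.1)%g).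

Fact reflext_mulA : associative reflext_mul.
Proof.
move=> [x e] [y f] [z g]; congr pair => /=; first by rewrite mulgA.
by apply/funext => r; rewrite addbA invgM !mulgA.
Qed.

Fact reflext_mul1 : left_id reflext_one reflext_mul.
Proof. by move=> [x e]; congr pair; rewrite /= mul1g. Qed.

Fact reflext_mulr1 : right_id reflext_one reflext_mul.
Proof.
move=> [x e]; congr pair => /=; rewrite ?mulg1 //.
by apply/funext => r; rewrite invg1 mul1g mulg1 addbF.
Qed.

Fact reflext_mulV : left_inverse reflext_one reflext_inv reflext_mul.
Proof.
move=> [x e]; congr pair => /=; rewrite ?mulVg //.
by apply/funext => r; rewrite !mulgA mulVg mul1g mulgVK addbb.
Qed.

Fact reflext_mulrV : right_inverse reflext_one reflext_inv reflext_mul.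
Proof.
move=> [x e]; congr pair => /=; rewrite ?mulgV //.
by apply/funext => r; rewrite invgK addbb.
Qed.

HB.instance Definition _ := isGroup.Build (reflext W)
  reflext_mulA reflext_mul1 reflext_mulr1 reflext_mulV reflext_mulrV.

Lemma reflext_mulE x y :
  (x * y)%g = ((x.1 * y.1)%g, fun r => x.2 (y.1 * r * y.1^-1)%g (+) y.2 r).
Proof. by []. Qed.

Lemma reflext_exp x n :
  (x ^+ n)%g = ((x.1 ^+ n)%g,
    fun r => \big[addb/false]_(k < n) x.2 (x.1 ^+ k * r * (x.1 ^+ k)^-1)%g).
Proof.
elim: n => [|n IH].
  by rewrite !expg0; congr pair; apply/funext => r; rewrite big_ord0.
rewrite !expgS IH reflext_mulE /=; congr pair; apply/funext => r.
by rewrite big_ord_recr /= addbC.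
Qed.

Definition reflext_gen (s : W) : reflext W := (s, fun r => r == s).

(* The reflections attached to the letters of the word (st)^n are those with
   (st)^j r = t for j < 2n; each occurs twice as soon as (st)^n = 1. *)
Lemma reflext_gen_braid (s t : W) n : (s * s)%g = 1%g -> (t * t)%g = 1%g ->
  ((s * t) ^+ n)%g = 1%g ->
  ((reflext_gen s * reflext_gen t) ^+ n)%g = 1%g.
Proof.
move=> ss tt; set x := (s * t)%g => xn.
have tV : (t^-1)%g = t by apply/esym/divg1_eq; rewrite invgK.
have sV : (s^-1)%g = s by apply/esym/divg1_eq; rewrite invgK.
have xV : (x^-1)%g = (t * s)%g by rewrite /x invgM sV tV.
have txV k : (t * x ^+ k = (x ^+ k)^-1 * t)%g.
  elim: k => [|k IH]; first by rewrite expg0 invg1 mul1g mulg1.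
  have tx : (t * x = x^-1 * t)%g by rewrite xV /x mulgA.
  by rewrite expgS mulgA tx -mulgA IH mulgA -invgM -expgSr -expgS.
pose b j r := (x ^+ j * r == t)%g.
have aux k r a : (x ^+ k * r * (x ^+ k)^-1 == a * t)%g =
    (x ^+ k * r == a * (x ^+ k)^-1 * t)%g.
  by rewrite divg_eq -[(a * t * _)%g]mulgA txV mulgA.
rewrite reflext_exp; congr pair => //=; apply/funext => r /=.
(* Since [t] conjugates [x] to its inverse, the letter [t] of the k-th factor tests [b] at 2k and
   the letter [s] tests it at 2k+1. *)
have -> : \big[addb/false]_(k < n)
    ((t * (x ^+ k * r * (x ^+ k)^-1) * t^-1 == s)
      (+) (x ^+ k * r * (x ^+ k)^-1 == t))%g
    = \big[addb/false]_(j < n + n) b j r.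
  elim: (n) => [|m IH]; first by rewrite !big_ord0.
  rewrite addnS addSn big_ord_recr IH !big_ord_recr /= -addbA; congr addb.
  have up k a : (x ^+ k * r == a)%g = (x ^+ m * (x ^+ k * r) == x ^+ m * a)%g.
    by rewrite (inj_eq (mulgI _)).
  rewrite addbC /b; congr addb.
    have := aux m r 1%g; rewrite !mul1g => ->.
    by rewrite up !mulgA mulgV mul1g -expgnDr.
  have -> : (t * (x ^+ m * r * (x ^+ m)^-1) * t^-1 == s)%g =
            (x ^+ m * r * (x ^+ m)^-1 == x^-1 * t)%g.
    rewrite tV -[LHS](inj_eq (mulgI t)) -[LHS](inj_eq (mulIg t)) xV.
    by rewrite !mulgA tt mul1g -!mulgA tt mulg1.
  rewrite aux -invgM -expgSr.
  rewrite -[LHS](inj_eq (mulgI (x ^+ m.+1)%g)) !mulgA mulgV mul1g -expgnDr.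
  by rewrite addSn.
rewrite big_split_ord /=.
rewrite [X in _ (+) X](eq_bigr (fun i : 'I_n => b i r)) ?addbb // => i _.
by rewrite /b expgnDr xn mul1g.
Qed.
End ReflectionExtension.

(** * The reflection cocycle, deletion and length *)

Section CoxeterTheory.
Variable W : coxeterSystem.
Implicit Types s t r w x y : W.

Lemma simpleV s : simple s -> (s^-1)%g = s.
Proof. by move=> /simple_sqr ss; apply/esym/divg1_eq; rewrite invgK. Qed.

Lemma simpleK s x : simple s -> (s * (s * x))%g = x.
Proof. by move=> /simple_sqr ss; rewrite mulgA ss mul1g. Qed.

Lemma simpleKr s x : simple s -> (x * s * s)%g = x.
Proof. by move=> /simple_sqr ss; rewrite -mulgA ss mulg1. Qed.

(** The elements [reflext_gen s] satisfy the defining relations, so the presentation yields a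
    homomorphism into [reflext W]. Its first component fixes the generators, hence is the identity;
    its second component is the cocycle. *)
Lemma cox_cocycle_ex : exists N : W -> W -> bool,
  (forall x y r, N (x * y)%g r = N x (y * r * y^-1)%g (+) N y r) /\
  (forall s r, simple s -> N s r = (r == s)).
Proof.
have rel s t n : simple s -> simple t -> ((s * t) ^+ n)%g = 1%g ->
    ((reflext_gen s * reflext_gen t) ^+ n)%g = 1%g.
  by move=> /simple_sqr ss /simple_sqr tt; apply: reflext_gen_braid.
have [phi phiE] := cox_presentation rel.
have phi1 w : (phi w).1 = w.
  have [ss [ssS <-]] := cox_generated w.
  elim: ss ssS => [|s ss IH] ssS.
    have phi11 : (phi 1 * phi 1 = phi 1 * 1)%g by rewrite -gmulfM !mulg1.
    by rewrite big_nil (mulgI _ _ _ phi11).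
  have sS : simple s by apply: ssS; rewrite inE eqxx.
  rewrite !big_cons gmulfM reflext_mulE /= phiE //.
  by rewrite IH // => t tss; apply: ssS; rewrite inE tss orbT.
exists (fun w => (phi w).2); split=> [x y r|s r sS]; last by rewrite phiE.
by rewrite gmulfM reflext_mulE /= phi1.
Qed.

Definition cox_cocycle : W -> W -> bool := sval (cid cox_cocycle_ex).
Local Notation N := cox_cocycle.

Lemma cox_cocycleM x y r : N (x * y)%g r = N x (y * r * y^-1)%g (+) N y r.
Proof. by rewrite /N; case: cid => ? []. Qed.

Lemma cox_cocycle_simple s r : simple s -> N s r = (r == s).
Proof. by rewrite /N; case: cid => ? [? H] /= /H. Qed.

Lemma cox_cocycle1 r : N 1%g r = false.
Proof.
have := cox_cocycleM 1%g 1%g r; rewrite invg1 !mul1g mulg1.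
by case: (N 1%g r).
Qed.

Lemma reflection_sqr t : cox_reflection t -> (t * t)%g = 1%g.
Proof.
by move=> [x [s [ss ->]]]; rewrite -!mulgA mulKg simpleK // mulgV.
Qed.

Lemma reflectionV t : cox_reflection t -> (t^-1)%g = t.
Proof. by move=> /reflection_sqr tt; apply/esym/divg1_eq; rewrite invgK. Qed.

Lemma reflectionKr t x : cox_reflection t -> (x * t * t)%g = x.
Proof. by move=> /reflection_sqr tt; rewrite -mulgA tt mulg1. Qed.

(** Write t = x s x^-1 and expand the cocycle along this product: the contributions of x and x^-1
    cancel because [N] vanishes at x x^-1 = 1, and N(s)(s) = 1 remains. *)
Lemma cox_cocycle_refl t : cox_reflection t -> N t t.
Proof.
move=> [x [s [sS ->]]].
have xt : (x^-1 * (x * s * x^-1) * x = s)%g by rewrite !mulgA mulVg mul1g mulgVK.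
have := cox_cocycleM x (x^-1)%g (x * s * x^-1)%g.
rewrite mulgV cox_cocycle1 invgK xt.
rewrite [N (x * s / x)%g _]cox_cocycleM invgK xt.
rewrite [N (x * s)%g _]cox_cocycleM mulgK (cox_cocycle_simple s sS) eqxx.
by case: (N x s); case: (N _ _).
Qed.

Lemma simple_reflection s : simple s -> cox_reflection s.
Proof. by move=> sS; exists 1%g, s; rewrite mul1g invg1 mulg1. Qed.

Lemma reflectionJ t x : cox_reflection t -> cox_reflection (x * t * x^-1)%g.
Proof.
by move=> [y [s [sS ->]]]; exists (x * y)%g, s; rewrite invgM !mulgA.
Qed.

Lemma len_word w : exists ss : seq W,
  [/\ forall s, s \in ss -> simple s, (\prod_(s <- ss) s)%g = w & size ss = len w].
Proof. by rewrite /len; case: ex_minnP => n /asboolP. Qed.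

Lemma len_min (ss : seq W) :
  (forall s, s \in ss -> simple s) -> (len (\prod_(s <- ss) s)%g <= size ss)%N.
Proof.
by move=> ssS; rewrite /len; case: ex_minnP => n _; apply; apply/asboolP; exists ss.
Qed.

(* The letters of a word at which the cocycle picks up [t] are those whose
   deletion right-multiplies the word by [t]. *)
Lemma cocycle_deletion (ss : seq W) t : (forall s, s \in ss -> simple s) ->
  N (\prod_(s <- ss) s)%g t -> exists ss' : seq W,
  [/\ forall s, s \in ss' -> simple s,
      (\prod_(s <- ss') s)%g = (\prod_(s <- ss) s * t)%g & (size ss').+1 = size ss].
Proof.
elim: ss => [|s ss IH] ssS; first by rewrite big_nil cox_cocycle1.
have sS : simple s by apply: ssS; rewrite inE eqxx.
have ssS' r : r \in ss -> simple r by move=> rss; apply: ssS; rewrite inE rss orbT.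
rewrite big_cons cox_cocycleM cox_cocycle_simple //.
have [sE _|_ /= /(IH ssS') [ss' [ss'S prod' size']]] := eqVneq.
  exists ss; split=> //.
  by rewrite -{1}(simpleK (\prod_(j <- ss) j)%g sS) -mulgA -{2}sE mulgVK.
exists (s :: ss'); split; rewrite /= ?size' //.
  by move=> r; rewrite inE => /orP[/eqP -> //|/ss'S].
by rewrite !big_cons prod' mulgA.
Qed.

(** If N(w)(t) = 1, deletion in a reduced word shortens w. Otherwise N(wt)(t) = N(w)(t) + N(t)(t) =
    1, and the first case applies to wt. *)
Lemma len_cocycle w t : cox_reflection t ->
  if N w t then (len (w * t)%g < len w)%N else (len w < len (w * t)%g)%N.
Proof.
have H x r : N x r -> (len (x * r)%g < len x)%N.
  have [ss [ssS <- <-]] := len_word x.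
  move=> /(cocycle_deletion ssS) [ss' [ss'S <- <-]].
  by rewrite ltnS len_min.
move=> tR; case: ifP => [/H //|Nw].
rewrite -{1}[w](reflectionKr _ tR); apply: H.
rewrite cox_cocycleM reflectionV // reflectionKr //.
by rewrite Nw cox_cocycle_refl.
Qed.

Lemma len_ltNge w t : cox_reflection t ->
  (len (w * t)%g < len w)%N = ~~ (len w < len (w * t)%g)%N.
Proof.
move=> /(len_cocycle w); case: ifP => _ lt; rewrite lt.
  by rewrite ltnNge (ltnW lt).
by rewrite ltnNge (ltnW lt).
Qed.

Lemma cocycleE w t : cox_reflection t -> N w t = (len (w * t)%g < len w)%N.
Proof.
move=> tR; have := len_cocycle w tR; case: ifP => // _.
by rewrite len_ltNge // => ->.
Qed.

Lemma lenV w : len (w^-1)%g = len w.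
Proof.
suff H x : (len (x^-1)%g <= len x)%N.
  by apply/eqP; rewrite eqn_leq H -{1}[w]invgK H.
have [ss [ssS <- <-]] := len_word x.
have -> : ((\prod_(s <- ss) s)^-1 = \prod_(s <- rev ss) s)%g.
  elim: ss ssS => [|s ss IH] ssS; first by rewrite !big_nil invg1.
  rewrite rev_cons big_cons invgM big_rcons /= IH; last first.
    by move=> r rss; apply: ssS; rewrite inE rss orbT.
  by rewrite simpleV //; apply: ssS; rewrite inE eqxx.
by rewrite -size_rev; apply: len_min => s; rewrite mem_rev => /ssS.
Qed.

Lemma len_simple_le s w : simple s -> (len (s * w)%g <= (len w).+1)%N.
Proof.
move=> sS; have [ss [ssS <- <-]] := len_word w.
have := @len_min (s :: ss); rewrite big_cons; apply => r.
by rewrite inE => /orP[/eqP -> //|/ssS].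
Qed.

(** Turns left multiplication by [s] into right multiplication by a reflection, the form in which
    length and Bruhat order are controlled. *)
Lemma mul_simpleE s w : (s * w = w * (w^-1 * s * w))%g.
Proof. by rewrite !mulgA mulgV mul1g. Qed.

Lemma conj_reflection s w : simple s -> cox_reflection (w^-1 * s * w)%g.
Proof.
move=> sS; rewrite -{2}(invgK w); apply: reflectionJ; exact: simple_reflection.
Qed.

Lemma len_simple s w : simple s ->
  (len (s * w)%g == (len w).+1) || (len w == (len (s * w)%g).+1).
Proof.
move=> sS; have le1 := len_simple_le w sS.
have := len_simple_le (s * w)%g sS; rewrite simpleK // => le2.
have := len_ltNge w (conj_reflection w sS); rewrite -mul_simpleE.
by move: le1 le2; lia.
Qed.

(* The cocycle values of x and sx at t agree unless xtx^-1 = s. *)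
Lemma exchange s x t : simple s -> cox_reflection t ->
  (len (x * t)%g < len x)%N != (len (s * x * t)%g < len (s * x)%g)%N ->
  (s * x = x * t)%g.
Proof.
move=> sS tR; rewrite -!cocycleE // [N (s * x)%g _]cox_cocycleM.
rewrite (cox_cocycle_simple _ sS).
have [<- _|_] := eqVneq (x * t / x)%g s; first by rewrite mulgVK.
by case: (N x t).
Qed.

(** * Bruhat order: lifting and finite lower intervals *)

Lemma bruhat_le_trans y x z : bruhat_le x y -> bruhat_le y z -> bruhat_le x z.
Proof. by move=> xy; elim=> // {}z t _ xz tR lt; apply: bruhat_step. Qed.

Lemma bruhat_le_len x y : bruhat_le x y -> (len x < len y)%N \/ x = y.
Proof.
elim=> [|{}y t _ [lt|->] _ lt']; first by right.
  by left; exact: ltn_trans lt'.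
by left.
Qed.

Lemma bruhat_ltP x y : bruhat_lt x y -> (len x < len y)%N.
Proof. by case=> /bruhat_le_len[]. Qed.

Lemma bruhat_lt_step x t : cox_reflection t -> (len x < len (x * t)%g)%N ->
  bruhat_lt x (x * t)%g.
Proof.
move=> tR lt; split; first by apply: bruhat_step => //; exact: bruhat_refl.
by move=> xE; move: lt; rewrite -xE ltnn.
Qed.

Lemma bruhat_lt_simple s x : simple s ->
  bruhat_lt x (s * x)%g <-> (len x < len (s * x)%g)%N.
Proof.
move=> sS; split; first exact: bruhat_ltP.
by rewrite mul_simpleE; apply: bruhat_lt_step; exact: conj_reflection.
Qed.

Lemma bruhat_gt_simple s x : simple s ->
  bruhat_lt (s * x)%g x <-> (len (s * x)%g < len x)%N.
Proof.
by move=> sS; have := bruhat_lt_simple (s * x)%g sS; rewrite simpleK.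
Qed.

(** Induction along the chain from x to w: at a step from y to yt, either sy < syt and the chain
    through sy continues, or exchange forces sy = yt. *)
Lemma bruhat_mul_simple s x w : simple s -> bruhat_le x w ->
  bruhat_le (s * x)%g w \/ bruhat_le (s * x)%g (s * w)%g.
Proof.
move=> sS; elim=> [|y t xy IH tR lt]; first by right; exact: bruhat_refl.
case: IH => [xy'|xy']; first by left; apply: bruhat_step.
have [lt'|ge] := boolP (len (s * y) < len (s * y * t))%N.
  by right; rewrite mulgA; apply: bruhat_step.
left; rewrite -(exchange sS tR) //.
by rewrite !len_ltNge // (negbTE ge) lt.
Qed.

(** The same induction; when sy < syt fails, exchange gives sy = yt, so left multiplication by s
    takes the new endpoint yt back to y. *)
Lemma bruhat_mul_simple2 s x w : simple s -> bruhat_le x w ->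
  bruhat_le (s * x)%g (s * w)%g \/ bruhat_le x (s * w)%g.
Proof.
move=> sS; elim=> [|y t xy IH tR lt]; first by left; exact: bruhat_refl.
have [lt'|ge] := boolP (len (s * y) < len (s * y * t))%N.
  by rewrite mulgA; case: IH => [xy'|xy']; [left|right]; apply: bruhat_step.
right; rewrite -(exchange sS tR) ?simpleK //.
by rewrite !len_ltNge // (negbTE ge) lt.
Qed.

(** Induction on length: if s begins a reduced word of w, each x below w has x or sx below sw. This
    makes the sums over Bruhat intervals genuine rather than the default value of an infinite
    sum. *)
Lemma bruhat_finite w : finite_set [set x | bruhat_le x w].
Proof.
have [n] := ubnP (len w); elim: n w => // n IH w lew.
have [[|s ss] [ssS wE size_ss]] := len_word w.
  apply: (@sub_finite_set _ _ [set w]) => // x /bruhat_le_len[|->] //.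
  by rewrite -size_ss.
have sS : simple s by apply: ssS; rewrite inE eqxx.
have lts : (len (s * w)%g < n)%N.
  rewrite -wE big_cons simpleK // (leq_ltn_trans (n := size ss)) //; last first.
    by move: lew; rewrite -size_ss.
  by apply: len_min => t tss; apply: ssS; rewrite inE tss orbT.
have fin := IH _ lts.
have fin2 := finite_image (fun x => s * x)%g fin.
have := conj fin fin2; rewrite -finite_setU; apply: sub_finite_set.
move=> x /(bruhat_mul_simple2 sS)[xw|xw]; [right|by left].
by exists (s * x)%g => //; rewrite simpleK.
Qed.

(** * Twisted involutions and the operation of a simple reflection on them *)

Section Star.
Variable st : diagramInvolution W.

Lemma star1 : st 1%g = 1%g.
Proof. by apply: (mulgI (st 1%g)); rewrite -star_mul !mulg1. Qed.

Lemma len_star w : len (st w) = len w.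
Proof.
suff H x : (len (st x) <= len x)%N.
  by apply/eqP; rewrite eqn_leq H -{1}[w](star_invol st) H.
have [ss [ssS <- <-]] := len_word x.
have -> : st (\prod_(s <- ss) s)%g = (\prod_(s <- map st ss) s)%g.
  elim: {ssS} ss => [|s ss IH]; first by rewrite !big_nil star1.
  by rewrite !big_cons star_mul IH.
rewrite -(size_map st ss); apply: len_min => s /mapP[t /ssS tS ->].
exact: star_simple.
Qed.

Lemma star_Istar y : Istar st y -> st y = (y^-1)%g.
Proof. by move=> /= yI; rewrite -{2}yI invgK. Qed.

(** Applying the star and then inversion, both of which preserve length, carries one element to the
    other. *)
Lemma len_mul_star s y : simple s -> Istar st y ->
  len (y * st s)%g = len (s * y)%g.
Proof.
move=> sS /star_Istar yI.
by rewrite -[LHS]len_star star_mul star_invol yI -[LHS]lenV invgM invgK simpleV.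
Qed.

(** The element s o y of I_*: the index besides y that occurs in T_s a_y. *)
Definition twist s y : W :=
  if (s * y == y * st s)%g then (s * y)%g else (s * y * st s)%g.

Lemma twist_comm s y : (s * y = y * st s)%g -> twist s y = (s * y)%g.
Proof. by rewrite /twist => ->; rewrite eqxx. Qed.

Lemma twist_ncomm s y : (s * y)%g <> (y * st s)%g ->
  twist s y = (s * y * st s)%g.
Proof. by rewrite /twist; case: eqP. Qed.

Section Twist.
Variables (s : W) (sS : simple s).

Lemma star_simpleV : ((st s)^-1)%g = st s.
Proof. by rewrite simpleV //; exact: star_simple. Qed.

Lemma twist_Istar y : Istar st y -> Istar st (twist s y).
Proof.
move=> yI; rewrite /twist /Istar /=; case: eqP => [yE|_].
  by rewrite star_mul (star_Istar yI) invgM invgK star_simpleV.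
by rewrite !star_mul (star_Istar yI) star_invol !invgM invgK star_simpleV simpleV
  // mulgA.
Qed.

(** An element and its twist fall in the same case of the definition; this makes [twist s] an
    involution. *)
Lemma twist_eq_comm y :
  (s * twist s y == twist s y * st s)%g = (s * y == y * st s)%g.
Proof.
have stS := star_simple st sS.
rewrite /twist; case: ifPn => [/eqP yE|yE].
  by rewrite simpleK // yE simpleKr // eqxx.
rewrite simpleKr // !mulgA simple_sqr // mul1g.
by rewrite eq_sym (negbTE yE).
Qed.

Lemma twistK : involutive (twist s).
Proof.
move=> y; have stS := star_simple st sS.
rewrite -[LHS]/(if _ then _ else _) twist_eq_comm /twist; case: (s * y == _)%g.
  by rewrite simpleK.
by rewrite !mulgA simple_sqr // mul1g simpleKr.
Qed.

(** If right multiplication by [st s] did not lengthen sy, then [s] and [st s] would meet the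
    hypothesis of exchange at y, giving the excluded equality. *)
Lemma len_twist_up y : Istar st y -> (s * y)%g <> (y * st s)%g ->
  (len y < len (s * y)%g)%N -> len (s * y * st s)%g = (len y).+2.
Proof.
move=> yI yE lt; have stS := star_simple st sS.
have stR := simple_reflection stS.
have lt' : (len (s * y) < len (s * y * st s))%N.
  rewrite ltnNge; apply/negP => ge; apply: yE; apply: exchange => //.
  by rewrite len_mul_star // ltnNge (ltnW lt) len_ltNge // -leqNgt ge.
have := len_simple y sS.
have := len_simple ((s * y)^-1)%g stS.
rewrite -[X in len (X * _)]star_simpleV -invgM !lenV.
move: lt lt'; move: (len (s * y * st s)%g) (len (s * y)%g) (len y) => a b c; lia.
Qed.

Lemma len_twist_down y : Istar st y -> (s * y)%g <> (y * st s)%g ->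
  (len (s * y)%g < len y)%N -> (len (s * y * st s)%g).+2 = len y.
Proof.
move=> yI yE lt; have stS := star_simple st sS.
have stR := simple_reflection stS.
have lt' : (len (s * y * st s) < len (s * y))%N.
  rewrite len_ltNge //; apply/negP => gt; apply: yE.
  have := @exchange s (s * y)%g (st s) sS stR; rewrite simpleK // => H.
  (* Exchange is applied at sy; multiplying its conclusion by [st s] gives back the excluded
     equality. *)
  have yE' : y = (s * y * st s)%g.
    apply: H; rewrite [X in X != _]len_ltNge // gt len_mul_star //.
    by rewrite [X in _ != X]lt.
  by rewrite {2}yE' simpleKr.
have := len_simple y sS.
have := len_simple ((s * y)^-1)%g stS.
rewrite -[X in len (X * _)]star_simpleV -invgM !lenV.
move: lt lt'; move: (len (s * y * st s)%g) (len (s * y)%g) (len y) => a b c; lia.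
Qed.

End Twist.
End Star.
End CoxeterTheory.

(** * Laurent polynomials and the involution v -> v^-1 *)

Section Zeval.
Variable R : comNzRingType.
Implicit Types (p q : {poly int}) (x : R).

Lemma zevalD p q x : zeval (p + q) x = zeval p x + zeval q x.
Proof. by rewrite /zeval rmorphD hornerD. Qed.
Lemma zevalB p q x : zeval (p - q) x = zeval p x - zeval q x.
Proof. by rewrite /zeval rmorphB hornerD hornerN. Qed.
Lemma zevalM p q x : zeval (p * q) x = zeval p x * zeval q x.
Proof. by rewrite /zeval rmorphM hornerM. Qed.
Lemma zevalC (c : int) x : zeval c%:P x = c%:~R.
Proof. by rewrite /zeval map_polyC hornerC. Qed.
Lemma zeval0 x : zeval 0 x = 0.
Proof. by rewrite /zeval rmorph0 horner0. Qed.
Lemma zeval1 x : zeval 1 x = 1.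
Proof. by rewrite /zeval rmorph1 hornerC. Qed.
Lemma zevalXn n x : zeval 'X^n x = x ^+ n.
Proof. by rewrite /zeval map_polyXn hornerXn. Qed.
Lemma zevalX x : zeval 'X x = x.
Proof. by rewrite /zeval map_polyX hornerX. Qed.
Lemma zeval_sum n (f : 'I_n -> {poly int}) x :
  zeval (\sum_i f i) x = \sum_i zeval (f i) x.
Proof. by rewrite /zeval rmorph_sum horner_sum. Qed.
Lemma zeval_coef p x : zeval p x = \sum_(i < size p) (p`_i)%:~R * x ^+ i.
Proof.
rewrite -{1}[p]coefK poly_def zeval_sum; apply: eq_bigr => i _.
by rewrite -mul_polyC zevalM zevalC zevalXn.
Qed.
End Zeval.

Lemma zeval_map (R S : comNzRingType) (f : {rmorphism R -> S}) p (x : R) :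
  f (zeval p x) = zeval p (f x).
Proof.
rewrite !zeval_coef rmorph_sum; apply: eq_bigr => i _.
by rewrite rmorphM rmorph_int rmorphXn.
Qed.

Section LaurentBar.

Lemma v_unit : v \is a GRing.unit. Proof. exact: lgen_unit. Qed.
(** Handed to [ring] as the relation tying [v^-1] to [v]. *)
Lemma vVK : v * v^-1 = 1. Proof. exact: (divrr v_unit). Qed.
Local Hint Resolve v_unit : core.

Lemma val_zeval_v p : laurent_val (zeval p v) = tofrac p.
Proof.
have {2}-> : p = zeval p 'X.
  rewrite zeval_coef -[LHS]coefK poly_def; apply: eq_bigr => i _.
  by rewrite -mul_polyC -(rmorph_int polyC) intz.
have valE (x : Av) : laurent_val x = val x by [].
by rewrite (zeval_map (@tofrac _)) valE (zeval_map val) /= /tgen expr1.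
Qed.

Lemma zeval_v_inj : injective (fun p => zeval p v).
Proof.
move=> p q /(congr1 (@laurent_val 1)); rewrite !val_zeval_v => /eqP.
by rewrite tofrac_eq => /eqP.
Qed.

Lemma laurent_zeval (x : Av) : exists p n, x = zeval p v / v ^+ n.
Proof.
have /asboolP[p [n xE]] := valP x; exists p, n; apply: (mulIr (unitrX n v_unit)).
rewrite divrK ?unitrX //; apply: val_inj.
rewrite rmorphM rmorphXn /= xE divfK ?expf_neq0 ?tofrac_eq0 ?polyX_eq0 //.
by rewrite val_zeval_v -val_zeval_v -[RHS]/(val _) (zeval_map val).
Qed.

(** The substitution of v^-1 for v, read off from a chosen fraction; [vbarE] shows that the choice
    is immaterial. *)
Definition vbar (x : Av) : Av :=
  let p := cid (laurent_zeval x) in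
  zeval (sval p) v^-1 * v ^+ sval (cid (svalP p)).

Lemma vbarE p n : vbar (zeval p v / v ^+ n) = zeval p v^-1 * v ^+ n.
Proof.
rewrite /vbar; case: cid => q /= qE; case: cid => m /= {qE} eqn.
(* Clearing denominators gives an identity in Z[X], which may be evaluated at v^-1 as well. *)
have : p * 'X^m = q * 'X^n.
  apply: zeval_v_inj; rewrite /= !zevalM !zevalXn.
  rewrite -[zeval p v](divrK (unitrX n v_unit)) eqn mulrAC divrK ?unitrX //.
move=> /(congr1 (fun f => zeval f v^-1)) /=; rewrite !zevalM !zevalXn => e.
have e' : zeval p v^-1 * v ^- m = zeval q v^-1 * v ^- n by rewrite -!exprVn.
have := congr1 (fun x => x * v ^+ m * v ^+ n) e'; rewrite /= divrK ?unitrX //.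
by rewrite mulrAC divrK ?unitrX // => ->.
Qed.

Lemma vbar_repr x y : exists p q n,
  x = zeval p v / v ^+ n /\ y = zeval q v / v ^+ n.
Proof.
have [p [m ->]] := laurent_zeval x; have [q [n ->]] := laurent_zeval y.
exists (p * 'X^n), (q * 'X^m), (m + n)%N; rewrite !zevalM !zevalXn exprD.
by rewrite invrM ?unitrX // [v ^- n * _]mulrC; split; rewrite mulrA;
  [rewrite mulrAC|]; rewrite mulrK ?unitrX // mulrAC mulrK ?unitrX.
Qed.

Lemma vbar_is_zmod_morphism : zmod_morphism vbar.
Proof.
move=> x y; have [p [q [n [-> ->]]]] := vbar_repr x y.
by rewrite -mulrBl -zevalB !vbarE zevalB mulrBl.
Qed.
Lemma vbar_is_monoid_morphism : monoid_morphism vbar.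
Proof.
split=> [|x y].
  by have := vbarE 1 0; rewrite !zeval1 expr0 divr1 mulr1.
have [p [q [n [-> ->]]]] := vbar_repr x y.
rewrite mulrACA -zevalM -invrM ?unitrX // -exprD !vbarE zevalM exprD.
by rewrite mulrACA.
Qed.
HB.instance Definition _ :=
  GRing.isZmodMorphism.Build Av Av vbar vbar_is_zmod_morphism.
HB.instance Definition _ :=
  GRing.isMonoidMorphism.Build Av Av vbar vbar_is_monoid_morphism.

Lemma vbar_v : vbar v = v^-1.
Proof. by have := vbarE 'X 0; rewrite !zevalX expr0 divr1 mulr1. Qed.

Lemma vbarV : vbar v^-1 = v.
Proof. by rewrite rmorphV //= vbar_v invrK. Qed.

Lemma vbar_zevalV p : vbar (zeval p v^-1) = zeval p v.
Proof. by rewrite zeval_map /= vbarV. Qed.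

Lemma zeval_vV_inj : injective (fun p => zeval p v^-1).
Proof. by move=> p q /(congr1 vbar); rewrite !vbar_zevalV => /zeval_v_inj. Qed.

Lemma Av_mulf_eq0 (x y : Av) : x * y = 0 -> (x == 0) || (y == 0).
Proof.
move=> /(congr1 val); rewrite rmorphM rmorph0 => /eqP; rewrite mulf_eq0.
by rewrite -!(rmorph0 (val : Av -> funfield)) !(inj_eq val_inj).
Qed.
HB.instance Definition _ :=
  GRing.ComUnitRing_isIntegral.Build (laurent 1) Av_mulf_eq0.

Lemma v2_neq0 : v + v^-1 != 0.
Proof.
apply/eqP => /(congr1 (fun x => x * v)) /=; rewrite mulrDl mulVr // mul0r => e.
have : zeval ('X * 'X + 1) v = zeval 0 v.
  by rewrite zevalD zevalM zevalX zeval1 zeval0.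
by move=> /zeval_v_inj /(congr1 (coefp 0%N)) /=; rewrite coefD coefXM coef1 coef0.
Qed.

(** Membership in v^-k Z[v^-1]; all later congruences are stated through it. *)
Definition vneg k (f : Av) : Prop := exists p, f = v ^- k * zeval p v^-1.

Lemma vneg0 k : vneg k 0.
Proof. by exists 0; rewrite zeval0 mulr0. Qed.

Lemma vnegD k f g : vneg k f -> vneg k g -> vneg k (f + g).
Proof. by move=> [p ->] [q ->]; exists (p + q); rewrite zevalD mulrDr. Qed.

Lemma vnegN k f : vneg k f -> vneg k (- f).
Proof.
by move=> [p ->]; exists (- p); rewrite -(sub0r p) zevalB zeval0 sub0r mulrN.
Qed.

Lemma vnegB k f g : vneg k f -> vneg k g -> vneg k (f - g).
Proof. by move=> nf /vnegN; apply: vnegD. Qed.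

Lemma vneg_sum k (I : eqType) (r : seq I) (F : I -> Av) :
  (forall i, i \in r -> vneg k (F i)) -> vneg k (\sum_(i <- r) F i).
Proof.
elim: r => [|i r IH] H; first by rewrite big_nil; exact: vneg0.
rewrite big_cons; apply: vnegD; first by apply: H; rewrite inE eqxx.
by apply: IH => j jr; apply: H; rewrite inE jr orbT.
Qed.

Lemma vnegM k l f g : vneg k f -> vneg l g -> vneg (k + l) (f * g).
Proof.
move=> [p ->] [q ->]; exists (p * q).
by rewrite zevalM -!exprVn exprD mulrACA.
Qed.

Lemma vneg_int (n : int) : vneg 0 n%:~R.
Proof. by exists n%:P; rewrite zevalC expr0 invr1 mul1r. Qed.

Lemma vneg_intM k (n : int) f : vneg k f -> vneg k (n%:~R * f).
Proof.
by move=> nf; rewrite -(add0n k); apply: vnegM => //; exact: vneg_int.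
Qed.

Lemma vneg_vV k : vneg k (v ^- k).
Proof. by exists 1; rewrite zeval1 mulr1. Qed.

Lemma vnegS k f : vneg k.+1 f -> vneg k f.
Proof.
move=> [p ->]; exists ('X * p).
by rewrite zevalM zevalX mulrA -!exprVn exprSr.
Qed.

Lemma vneg_mulv k f : vneg k.+1 f -> vneg k (v * f).
Proof.
by move=> [p ->]; exists p; rewrite mulrA -!exprVn exprS mulrA divrr // mul1r.
Qed.

Lemma vneg_mulV k f : vneg k f -> vneg k.+1 (v^-1 * f).
Proof. by move=> nf; rewrite -addn1 addnC; apply: vnegM => //; apply: vneg_vV. Qed.

(** The bar turns negative exponents into positive ones. Clearing denominators, a nonzero p would
    equal, after multiplication by a positive power of X, a polynomial of no larger size. *)
Lemma vneg_bar_eq0 f : vneg 1 f -> vbar f = f -> f = 0.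
Proof.
move=> [p ->]; rewrite expr1 rmorphM /= vbarV vbar_zevalV => e.
have [->|p0] := eqVneq p 0; first by rewrite zeval0 mulr0.
(* The reversal of p: its coefficients in the opposite order. *)
pose q : {poly int} := \sum_(i < size p) p`_i *: 'X^(size p - i.+1).
have qE : zeval q v = v ^+ (size p).-1 * zeval p v^-1.
  rewrite zeval_sum zeval_coef mulr_sumr; apply: eq_bigr => i _.
  rewrite -mul_polyC zevalM zevalC zevalXn mulrCA; congr (_ * _).
  have -> : ((size p).-1 = (size p - i.+1) + i)%N by have := ltn_ord i; lia.
  by rewrite exprD exprVn mulrK ?unitrX.
have : 'X^((size p).-1.+2) * p = q.
  apply: zeval_v_inj; rewrite /= qE zevalM zevalXn -addn2 exprD -mulrA expr2 -mulrA e.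
  by rewrite mulVKr.
move=> /(congr1 (fun p : {poly int} => size p)); rewrite size_mul //;
  last exact: monic_neq0 (monicXn _ _).
rewrite size_polyXn.
have : (size q <= size p)%N.
  apply: (leq_trans (size_sum _ _ _)); apply/bigmax_leqP => i _.
  apply: (leq_trans (size_scale_leq _ _)); rewrite size_polyXn.
  by have := ltn_ord i; lia.
by move: p0; rewrite -size_poly_gt0; lia.
Qed.
End LaurentBar.

(** * Exponents of pi and vanishing of its coefficients mu' and mu'' *)

Section Mu.
Variables (W : coxeterSystem) (st : diagramInvolution W).
Variable P : W -> W -> {poly int}.
Hypothesis P_diag : forall w, Istar st w -> P w w = 1.
Hypothesis P_deg : forall y w, Istar st y -> Istar st w -> bruhat_lt y w ->
  ((size (P y w)).-1 <= (len w - len y - 1)./2)%N.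

Lemma pi_diag w : Istar st w -> pi_ P w w = 1.
Proof.
move=> wI; rewrite /pi_ asboolT; last exact: bruhat_refl.
by rewrite addNr expr0z P_diag // zeval1 rmorph1 mul1r.
Qed.

Lemma pi_out y w : ~ bruhat_le y w -> pi_ P y w = 0.
Proof. by rewrite /pi_ => /asboolPn/negbTE ->. Qed.

(** For y < w and d = l(w) - l(y), the term of degree i in P contributes v^-(d - 2i). All exponents
    of v^-1 thus have the parity of d. *)
Lemma pi_zeval y w : Istar st y -> Istar st w -> exists q : {poly int},
  pi_ P y w = zeval q v^-1 /\
  (forall j, odd j != odd (len w - len y) -> q`_j = 0) /\
  (y <> w -> q`_0 = 0).
Proof.
move=> yI wI; have [yw|yw] := pselect (bruhat_le y w); last first.
  exists 0; rewrite pi_out // zeval0; split=> //.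
  by split=> *; rewrite coef0.
have [->|yDw] := eqVneq y w.
  exists 1; rewrite pi_diag // zeval1 subnn; split=> //; split=> // j.
  by rewrite coef1; case: j.
have ywlt : bruhat_lt y w by split=> //; apply/eqP.
have lt := bruhat_ltP ywlt; set d := (len w - len y)%N.
(* The degree bound keeps d - 2i positive, which removes the constant term. *)
have Pd i : (i < size (P y w))%N -> (i.*2 < d)%N.
  by move=> ltP; have := P_deg yI wI ywlt; rewrite -/d /d; lia.
exists (\sum_(i < size (P y w)) (P y w)`_i *: 'X^(d - i.*2)); split.
  rewrite /pi_ asboolT // zeval_map /= incl_u zeval_sum zeval_coef mulr_sumr.
  apply: eq_bigr => i _; rewrite -[in RHS]mul_polyC zevalM zevalC zevalXn.
  rewrite mulrCA; congr (_ * _); have := Pd i (ltn_ord i) => lti.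
  have -> : - (len w)%:Z + (len y)%:Z = - ((d - i.*2) + i.*2)%N%:Z by lia.
  rewrite -exprnN exprD exprVn -exprM mul2n invrM ?unitrX ?v_unit //.
  by rewrite mulrAC mulVr ?unitrX ?v_unit // mul1r.
split=> [j jd|_]; rewrite coef_sum big1 // => i _; rewrite coefZ coefXn.
  have := Pd i (ltn_ord i) => lti; have [jE|_] := eqVneq j; last by rewrite mulr0.
  by move: jd; rewrite jE oddB ?odd_double ?addbF ?eqxx // ltnW.
by have := Pd i (ltn_ord i); case: eqP => [e|]; rewrite ?mulr0 //; lia.
Qed.

Lemma pi_vneg0 y w : Istar st y -> Istar st w -> vneg 0 (pi_ P y w).
Proof.
move=> yI wI; have [q [-> _]] := pi_zeval yI wI.
by exists q; rewrite expr0 invr1 mul1r.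
Qed.

Lemma pi_vneg1 y w : Istar st y -> Istar st w -> y <> w -> vneg 1 (pi_ P y w).
Proof.
move=> yI wI yDw; have [q [-> [_ /(_ yDw) q0]]] := pi_zeval yI wI.
exists (\poly_(i < size q) q`_i.+1); rewrite expr1 -{2}(zevalX v^-1) -zevalM.
congr (zeval _ _); apply/polyP => [[|i]]; rewrite coefXM //= coef_poly.
by case: ltnP => // /leqW; rewrite -/(leq _ _) => le; rewrite nth_default.
Qed.

Variables mu1 mu2 : W -> W -> int.
Hypothesis Hmu : is_mu st P mu1 mu2.

Lemma mu_pi y w : Istar st y -> Istar st w ->
  vneg 3 (pi_ P y w -
    ((y == w)%:R + (mu1 y w)%:~R * v ^- 1 + (mu2 y w)%:~R * v ^- 2)).
Proof. by move=> yI wI; have [p ->] := Hmu yI wI; exists p. Qed.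

(** Evaluation at v^-1 is injective, so the defining congruence identifies mu' and mu'' with honest
    coefficients, to which the parity of exponents applies. *)
Lemma mu_coef y w : Istar st y -> Istar st w -> exists q : {poly int},
  [/\ pi_ P y w = zeval q v^-1, mu1 y w = q`_1, mu2 y w = q`_2
    & forall j, odd j != odd (len w - len y) -> q`_j = 0].
Proof.
move=> yI wI; have [q [piE [qodd _]]] := pi_zeval yI wI.
have [p] := Hmu yI wI; rewrite piE => /(canRL (subrK _)) e.
have : q = 'X^3 * p + ((y == w)%:R%:P + (mu1 y w)%:P * 'X + (mu2 y w)%:P * 'X^2).
  apply: zeval_vV_inj; rewrite /= e !zevalD [zeval ('X^3 * p) _]zevalM.
  rewrite [zeval 'X^3 _]zevalXn [zeval ((mu1 y w)%:P * _) _]zevalM.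
  rewrite [zeval ((mu2 y w)%:P * _) _]zevalM [zeval 'X^2 _]zevalXn.
  rewrite !zevalC zevalX.
  by rewrite !exprVn expr1 rmorph_nat.
move=> qE; exists q; split=> //; rewrite qE !coefD !coefC coefXnM !coefCM !coefXn
  coefX /=; ring.
Qed.

(** Either y = w, where pi is the constant 1, or pi is 0. *)
Lemma mu_out y w : Istar st y -> Istar st w -> ~ bruhat_lt y w ->
  mu1 y w = 0 /\ mu2 y w = 0.
Proof.
move=> yI wI yw; have [q [piE -> -> _]] := mu_coef yI wI.
have [e|yDw] := eqVneq y w.
  suff -> : q = 1 by rewrite !coef1.
  by apply: zeval_vV_inj; rewrite /= -piE e pi_diag // zeval1.
suff -> : q = 0 by rewrite !coef0.
apply: zeval_vV_inj; rewrite /= -piE pi_out ?zeval0 // => le.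
by apply: yw; split=> //; apply/eqP.
Qed.
(** For lengths of equal parity only even powers of v^-1 occur in pi. *)
Lemma mu1_parity y w : Istar st y -> Istar st w ->
  odd (len y) = odd (len w) -> mu1 y w = 0.
Proof.
move=> yI wI e; have [le|gt] := leqP (len y) (len w); last first.
  have /(mu_out yI wI)[? ?] // : ~ bruhat_lt y w.
  by move=> /bruhat_ltP; rewrite ltnNge (ltnW gt).
 have [q [_ -> _]] := mu_coef yI wI; apply.
by rewrite oddB // e addbb.
Qed.

Lemma mu2_parity y w : Istar st y -> Istar st w ->
  odd (len y) != odd (len w) -> mu2 y w = 0.
Proof.
move=> yI wI e; have [le|gt] := leqP (len y) (len w); last first.
  have /(mu_out yI wI)[? ?] // : ~ bruhat_lt y w.
  by move=> /bruhat_ltP; rewrite ltnNge (ltnW gt).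
 have [q [_ _ ->]] := mu_coef yI wI; apply.
by rewrite oddB //; case: odd e; case: odd.
Qed.

End Mu.

(** * Coordinates and the action of [c_s] *)

Lemma sum_extend (V : zmodType) (I : eqType) (r r' : seq I) (F : I -> V) :
  uniq r -> uniq r' -> {subset r <= r'} ->
  \sum_(i <- r) F i = \sum_(i <- r') if i \in r then F i else 0.
Proof.
move=> ur ur' sub; rewrite -big_mkcond -big_filter; apply: perm_big.
apply: uniq_perm; rewrite ?filter_uniq // => i; rewrite mem_filter.
by case ir: (i \in r) => //=; rewrite sub.
Qed.

Lemma sum_delta (R : nzRingType) (V : lmodType R) (I : eqType) (r : seq I)
    (F : I -> V) i : uniq r -> i \in r ->
  \sum_(j <- r) (j == i)%:R *: F j = F i.
Proof.
move=> ur ir; rewrite (big_rem i) //= eqxx scale1r big1_seq ?addr0 // => j /=.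
by rewrite mem_rem_uniq // inE => /andP[/negbTE -> _]; rewrite scale0r.
Qed.

(** Coordinates are taken from a chosen expansion and extended by zero. Independence on the union of
    two supports makes them independent of the choice, and linearity follows. *)
Lemma basis_coord (R : nzRingType) (V : lmodType R) (I : choiceType)
    (D : set I) (b : I -> V) (i : I) : is_basis_on D b -> exists k : V -> R,
  (forall a x y, k (a *: x + y) = a * k x + k y) /\
  (D i -> forall j, D j -> k (b j) = (i == j)%:R).
Proof.
move=> [gen ind].
pose rep x (rc : seq I * (I -> R)) := [/\ uniq rc.1,
  forall j, j \in rc.1 -> D j & x = \sum_(j <- rc.1) rc.2 j *: b j].
have gen' x : exists rc, rep x rc by have [r [c]] := gen x; exists (r, c).
pose ext (rc : seq I * (I -> R)) j := if j \in rc.1 then rc.2 j else 0.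
have extE x rc r : rep x rc -> uniq r -> {subset rc.1 <= r} ->
    x = \sum_(j <- r) ext rc j *: b j.
  move=> [urc _ ->] ur sub; rewrite (sum_extend _ urc ur sub).
  by apply: eq_bigr => j _; rewrite /ext; case: ifP; rewrite ?scale0r.
have ext_uniq x rc rc' : rep x rc -> rep x rc' -> ext rc =1 ext rc'.
  move=> xrc xrc' j; pose r := undup (rc.1 ++ rc'.1).
  have sub : {subset rc.1 <= r} by move=> l; rewrite mem_undup mem_cat => ->.
  have sub' : {subset rc'.1 <= r}.
    by move=> l; rewrite mem_undup mem_cat orbC => ->.
  have [jr|jr] := boolP (j \in r); last first.
    rewrite /ext; case: ifP => [/sub jr'|_]; first by rewrite jr' in jr.
    by case: ifP => // /sub' jr'; rewrite jr' in jr.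
  apply/eqP; rewrite -subr_eq0; apply/eqP.
  apply: (ind r (fun j => ext rc j - ext rc' j)) => //; first exact: undup_uniq.
    move=> l; rewrite mem_undup mem_cat.
    by case: xrc xrc' => _ rD _ [_ rD' _] /orP[/rD|/rD'].
  under eq_bigr do rewrite scalerBl.
  rewrite sumrB -(extE x rc) ?undup_uniq // -(extE x rc') ?undup_uniq //.
  by rewrite subrr.
exists (fun x => ext (sval (cid (gen' x))) i); split=> [a x y|iD j jD].
  case: (cid (gen' x)) => rx /= xrx; case: (cid (gen' y)) => ry /= yry.
  case: cid => rz /= zrz; pose r := undup (rx.1 ++ ry.1).
  have subx : {subset rx.1 <= r} by move=> l; rewrite mem_undup mem_cat => ->.
  have suby : {subset ry.1 <= r}.
    by move=> l; rewrite mem_undup mem_cat orbC => ->.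
  have zr : rep (a *: x + y) (r, fun j => a * ext rx j + ext ry j).
    split=> /=; first exact: undup_uniq.
      move=> l; rewrite mem_undup mem_cat.
      by case: xrx yry => _ rD _ [_ rD' _] /orP[/rD|/rD'].
    under eq_bigr do rewrite scalerDl -scalerA.
    by rewrite big_split /= -scaler_sumr -(extE x) ?undup_uniq // -(extE y)
      ?undup_uniq.
  rewrite (ext_uniq _ _ _ zrz zr) /ext /=; case: ifPn => // ir.
  have nx : (i \in rx.1) = false by apply: contraNF ir => /subx.
  have ny : (i \in ry.1) = false by apply: contraNF ir => /suby.
  by rewrite nx ny mulr0 addr0.
have jrep : rep (b j) ([:: j], fun=> 1).
  split=> [//|l|/=]; first by rewrite inE => /eqP ->.
  by rewrite big_seq1 scale1r.
case: cid => rc /= bj; rewrite (ext_uniq _ _ _ bj jrep) /ext /= inE.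
by case: eqP.
Qed.

Section Module.
Variables (W : coxeterSystem) (st : diagramInvolution W) (H : heckeAlgebra W).
Variables (M : involutionModule st H) (HX : heckeExtension H).
Variable MX : moduleExtension M HX.
Implicit Types (s y z w : W) (X Y : MX).

(** The normalized element a'_z; [locked] stops simplification from unfolding it. *)
Definition std z : MX := locked (v ^ (- (len z)%:Z) *: mj MX (ma M z)).

Lemma stdE z : std z = v ^ (- (len z)%:Z) *: mj MX (ma M z).
Proof. by rewrite /std -lock. Qed.

(** A coordinate on [M], followed by [inclA], is semilinear, so the universal property of base
    change extends it to [MX]. The factor v^(len y) compensates for the normalization. *)
Lemma std_coord_ex y : exists k : MX -> Av,
  (forall a X Y, k (a *: X + Y) = a * k X + k Y) /\
  (Istar st y -> forall z, Istar st z -> k (std z) = (z == y)%:R).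
Proof.
have [k [kl kE]] := basis_coord y (ma_basis M).
pose g (m : M) : Av^o := inclA (k m).
have gl a (x x' : M) : g (a *: x + x') = (inclA \; *:%R) a (g x) + g x'.
  by rewrite /g kl rmorphD rmorphM.
pose G : {linear M -> Av^o | inclA \; *:%R} :=
  HB.pack g (GRing.isLinear.Build Au M Av^o (inclA \; *:%R) g gl).
have [g' g'E _] := mj_base_change MX G.
exists (fun X => v ^ (len y)%:Z * g' X); split=> [a X Y|yI z zI].
  by rewrite linearD linearZ /= mulrDr mulrCA.
rewrite stdE linearZ /= g'E /G /= /g kE // [y == z]eq_sym rmorph_nat /=.
have [->|] := eqVneq z y; last by rewrite scaler0 mulr0.
by rewrite [_ *: _]mulr1 -(exprzDr v_unit) addrN expr0z.
Qed.

Definition std_coord y : MX -> Av := sval (cid (std_coord_ex y)).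

Lemma std_coordP y a X Y :
  std_coord y (a *: X + Y) = a * std_coord y X + std_coord y Y.
Proof. by rewrite /std_coord; case: cid => k [/= kl _]; rewrite kl. Qed.

Lemma std_coordD y X Y : std_coord y (X + Y) = std_coord y X + std_coord y Y.
Proof. by rewrite -{1}[X]scale1r std_coordP mul1r. Qed.

Lemma std_coord0 y : std_coord y 0 = 0.
Proof. by apply: (addrI (std_coord y 0)); rewrite -std_coordD !addr0. Qed.

Lemma std_coordZ y a X : std_coord y (a *: X) = a * std_coord y X.
Proof. by rewrite -[a *: X]addr0 std_coordP std_coord0 addr0. Qed.

Lemma std_coordB y X Y : std_coord y (X - Y) = std_coord y X - std_coord y Y.
Proof. by rewrite -scaleN1r std_coordD std_coordZ mulN1r. Qed.

Lemma std_coord_sum y (I : Type) (r : seq I) (F : I -> MX) :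
  std_coord y (\sum_(i <- r) F i) = \sum_(i <- r) std_coord y (F i).
Proof. exact: (big_morph _ (std_coordD y) (std_coord0 y)). Qed.

Lemma std_coord_std y z : Istar st y -> Istar st z ->
  std_coord y (std z) = (z == y)%:R.
Proof.
by move=> yI zI; rewrite /std_coord; case: cid => k [/= _ kE]; rewrite kE.
Qed.

(** The expansion is required on every list containing [r], so that two expansions can be compared
    on a common list when adding. *)
Definition istar_span X : Prop := exists2 r : seq W,
  (forall y, y \in r -> Istar st y) &
  forall r', uniq r' -> (forall y, y \in r' -> Istar st y) -> {subset r <= r'} ->
    X = \sum_(y <- r') std_coord y X *: std y.

Lemma span_std z : Istar st z -> istar_span (std z).
Proof.
move=> zI; exists [:: z] => [y|r ur rI sub]; first by rewrite inE => /eqP ->.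
have zr : z \in r by apply: sub; rewrite inE.
rewrite -[LHS](sum_delta std ur zr); apply: eq_big_seq => y yr.
by have yI := rI _ yr; rewrite std_coord_std // eq_sym.
Qed.

Lemma span_linear a X Y : istar_span X -> istar_span Y -> istar_span (a *: X + Y).
Proof.
move=> [r rI Xr] [r' rI' Yr]; exists (r ++ r') => [y|r2 ur2 r2I sub].
  by rewrite mem_cat => /orP[/rI|/rI'].
under eq_bigr do rewrite std_coordP scalerDl -scalerA.
rewrite big_split /= -scaler_sumr -Xr //; last first.
  by move=> y yr; apply: sub; rewrite mem_cat yr.
by rewrite -Yr // => y yr; apply: sub; rewrite mem_cat yr orbT.
Qed.

Lemma span0 : istar_span 0.
Proof.
by exists [::] => // r _ _ _; rewrite big1 // => y _; rewrite std_coord0 scale0r.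
Qed.

Lemma spanZ a X : istar_span X -> istar_span (a *: X).
Proof.
by move=> sX; rewrite -[_ *: _]addr0; apply: span_linear => //; exact: span0.
Qed.

Lemma spanD X Y : istar_span X -> istar_span Y -> istar_span (X + Y).
Proof. by move=> sX; move=> sY; rewrite -[X]scale1r; apply: span_linear. Qed.

Lemma spanB X Y : istar_span X -> istar_span Y -> istar_span (X - Y).
Proof. by move=> sX sY; rewrite addrC -scaleN1r; apply: span_linear. Qed.

Lemma span_sum (I : eqType) (r : seq I) (F : I -> MX) :
  (forall i, i \in r -> istar_span (F i)) -> istar_span (\sum_(i <- r) F i).
Proof.
elim: r => [|i r IH] FS; first by rewrite big_nil; exact: span0.
rewrite big_cons; apply: spanD; first by apply: FS; rewrite inE eqxx.
by apply: IH => j jr; apply: FS; rewrite inE jr orbT.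
Qed.

Lemma span_expand X : istar_span X -> exists r : seq W,
  [/\ uniq r, forall y, y \in r -> Istar st y
    & X = \sum_(y <- r) std_coord y X *: std y].
Proof.
move=> [r rI Xr]; exists (undup r); split; first exact: undup_uniq.
  by move=> y; rewrite mem_undup; exact: rI.
by apply: Xr; rewrite ?undup_uniq // => y; rewrite mem_undup //; exact: rI.
Qed.

Lemma span_ind (Q : MX -> Prop) :
  (forall a X Y, istar_span X -> istar_span Y -> Q X -> Q Y -> Q (a *: X + Y)) ->
  Q 0 -> (forall z, Istar st z -> Q (std z)) ->
  forall X, istar_span X -> Q X.
Proof.
move=> QD Q0 Qstd X /span_expand[r [_ rI ->]].
have : istar_span (\sum_(y <- r) std_coord y X *: std y) /\
    Q (\sum_(y <- r) std_coord y X *: std y); last by case.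
elim: r rI => [|y r IH] rI; first by rewrite big_nil; split=> //; exact: span0.
have yI : Istar st y by apply: rI; rewrite inE eqxx.
have [|SX QX] := IH; first by move=> z zr; apply: rI; rewrite inE zr orbT.
rewrite big_cons; split; first by apply: span_linear => //; exact: span_std.
by apply: QD => //; [exact: span_std|exact: Qstd].
Qed.

Section Action.
Variables (s : W) (sS : simple s).

Definition cact : MX -> MX := mxact (c_ HX s).
HB.instance Definition _ := GRing.isLinear.Build Av MX MX *:%R cact
  (act_linear_r (mxactP MX) (c_ HX s)).

Lemma vV2 : (inclA u)^-1 = v^-1 ^+ 2.
Proof. by rewrite incl_u exprVn. Qed.

Lemma cact_mj (m : M) :
  cact (mj MX m) = v^-1 ^+ 2 *: mj MX (mact (hT H s) m + m).
Proof.
have lin := act_linear_l (mxactP MX) (mj MX m).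
have := lin (inclA u)^-1 (hj HX (hT H s) + 1) 0; rewrite addr0 => /= e.
have := lin (-1) 0 0; rewrite /= scaler0 addr0 scaleN1r addNr => z.
have := lin 1 (hj HX (hT H s)) 1; rewrite !scale1r => /= d.
by rewrite /cact /c_ e z addr0 d mxactE (act_one (mxactP MX)) -linearD vV2.
Qed.

Local Notation up z := (len z < len (s * z)%g)%N.
Local Notation comm z := (s * z == z * st s)%g.

(** Diagonal entry of c_s in the basis a'_z. *)
Definition diag_coef z : Av :=
  if comm z then if up z then 1 + v^-1 ^+ 2 else v ^+ 2 - 1
  else if up z then v^-1 ^+ 2 else v ^+ 2.
(** Entry of c_s from a'_z to a'_(s o z); it is bar invariant and nonzero when s lengthens z. *)
Definition twist_coef z : Av :=
  if comm z then if up z then v + v^-1 else v - v^-1 else 1.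

Lemma len_up z : up z -> len (s * z)%g = (len z).+1.
Proof. by have := len_simple z sS; lia. Qed.

Lemma len_down z : ~~ up z -> len z = (len (s * z)%g).+1.
Proof. by have := len_simple z sS; lia. Qed.

Lemma mj_std z : mj MX (ma M z) = v ^+ len z *: std z.
Proof.
rewrite stdE scalerA -[v ^+ len z]/(v ^ (len z)%:Z) -(exprzDr v_unit).
by rewrite addrN scale1r.
Qed.

(** Treats the four rules for T_s at once, the rescaling by powers of v included. *)
Lemma cact_std_coef z z' c d :
  mact (hT H s) (ma M z) = c *: ma M z + d *: ma M z' ->
  cact (std z) = (v^-1 ^+ 2 * (inclA c + 1)) *: std z +
    (v^-1 ^+ len z * v^-1 ^+ 2 * inclA d * v ^+ len z') *: std z'.
Proof.
move=> e; have -> : cact (std z) = v^-1 ^+ len z *: cact (mj MX (ma M z)).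
  by rewrite stdE linearZ /= -exprnN -exprVn.
rewrite cact_mj e; move: (mj_std z) (mj_std z').
move: (std z) (std z') => A B eA eB; rewrite !linearD !linearZ /= eA eB.
rewrite addrAC !scalerA -scalerDl.
have eVn : v ^+ len z * v^-1 ^+ len z = 1 by rewrite -exprMn vVK expr1n.
by congr (_ *: _ + _ *: _); [ring: eVn|ring].
Qed.

Lemma cact_std z : Istar st z ->
  cact (std z) = diag_coef z *: std z + twist_coef z *: std (twist st s z).
Proof.
move=> zI; rewrite /diag_coef /twist_coef.
have eV := vVK.
have eVn n : v ^+ n * v^-1 ^+ n = 1 by rewrite -exprMn vVK expr1n.
have [le|gt] := boolP (up z);
  case: (eqVneq (s * z)%g (z * st s)%g) => [cm|/eqP cm].
- have ltz : bruhat_lt z (s * z)%g by exact/bruhat_lt_simple.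
  have := eVn (len z).
  rewrite (cact_std_coef (mact_comm_up M sS zI cm ltz)) twist_comm // len_up //.
  rewrite rmorphD rmorph1 /= incl_u [v ^+ (len z).+1]exprSr.
  move: (v ^+ len _) (v^-1 ^+ len _) => a b e0.
  by clear -eV e0; congr (_ *: _ + _ *: _); ring: eV e0.
- have ltz : bruhat_lt z (s * z)%g by exact/bruhat_lt_simple.
  have := eVn (len z).
  have e := mact_ncomm_up M sS zI cm ltz.
  (* Pads the one-term rule to coefficients 0 and 1. *)
  rewrite -[RHS]add0r -[X in X + _](scale0r (ma M z)) -[X in _ + X]scale1r in e.
  rewrite (cact_std_coef e) twist_ncomm // len_twist_up // rmorph0 rmorph1.
  rewrite [v ^+ (len z).+2]exprSr [v ^+ (len z).+1]exprSr.
  move: (v ^+ len _) (v^-1 ^+ len _) => a b e0.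
  by clear -eV e0; congr (_ *: _ + _ *: _); ring: eV e0.
- have ltz : bruhat_lt (s * z)%g z
    by apply/bruhat_gt_simple => //; rewrite (len_down gt).
  have := eVn (len (s * z)%g).
  rewrite (cact_std_coef (mact_comm_down M sS zI cm ltz)) twist_comm //.
  rewrite (len_down gt).
  rewrite !rmorphB !rmorphXn rmorph1 /= !incl_u [v^-1 ^+ (len _).+1]exprSr.
  move: (v ^+ len _) (v^-1 ^+ len _) => a b e0.
  by clear -eV e0; congr (_ *: _ + _ *: _); ring: eV e0.
- have ltz : bruhat_lt (s * z)%g z
    by apply/bruhat_gt_simple => //; rewrite (len_down gt).
  have := eVn (len (s * z * st s)%g).
  rewrite (cact_std_coef (mact_ncomm_down M sS zI cm ltz)) twist_ncomm //.
  rewrite -(len_twist_down sS zI cm (bruhat_ltP ltz)).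
  rewrite !rmorphB !rmorphXn rmorph1 /= !incl_u.
  rewrite [v^-1 ^+ (len _).+2]exprSr [v^-1 ^+ (len _).+1]exprSr.
  move: (v ^+ len _) (v^-1 ^+ len _) => a b e0.
  by clear -eV e0; congr (_ *: _ + _ *: _); ring: eV e0.
Qed.
End Action.
End Module.

(** * The bar involution on coordinates *)

Section BarInvariance.
Variables (W : coxeterSystem) (st : diagramInvolution W) (H : heckeAlgebra W).
Variables (M : involutionModule st H) (HX : heckeExtension H).
Variable MX : moduleExtension M HX.
Implicit Types (s y z w : W) (X Y : MX).
Local Notation std := (std MX).
Local Notation span := (@istar_span _ _ _ _ _ MX).

Lemma span_cact s X : simple s -> span X -> span (cact s X).
Proof.
move=> sS; elim/span_ind: X / => [a X Y _ _ sX sY||z zI].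
- by rewrite linearP; apply: span_linear.
- by rewrite linear0; exact: span0.
rewrite cact_std //; apply: spanD; apply: spanZ; apply: span_std => //.
exact: twist_Istar.
Qed.

(** The transpose of [cact_std]: only a'_y and a'_(s o y) contribute to the coordinate at y. *)
Lemma std_coord_cact s y X : simple s -> Istar st y -> span X ->
  std_coord y (cact s X) = diag_coef st s y * std_coord y X +
    twist_coef st s (twist st s y) * std_coord (twist st s y) X.
Proof.
move=> sS yI; have tI := twist_Istar sS yI.
elim/span_ind: X / => [a X Y _ _ eX eY||z zI].
- rewrite linearP !std_coordP eX eY; ring.
- by rewrite linear0 !std_coord0 !mulr0 addr0.
have tzI := twist_Istar sS zI.
rewrite cact_std // std_coordD !std_coordZ.
rewrite (std_coord_std MX yI zI) (std_coord_std MX yI tzI) (std_coord_std MX tI zI).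
have -> : (twist st s z == y) = (z == twist st s y).
  by apply/eqP/eqP => [<-|->]; rewrite twistK.
have [->|zy] := eqVneq z y.
  by case: eqP => [<-|_]; rewrite ?mulr0.
by case: eqP => [->|_]; rewrite ?mulr0 // twistK.
Qed.

(** By additivity, the rule on monomials v^n extends to all Laurent polynomials. *)
Lemma mxbar_mj (f : Av) (m : M) :
  mxbar MX (f *: mj MX m) = vbar f *: mj MX (mbar M m).
Proof.
have [p [n ->]] := laurent_zeval f; rewrite vbarE !zeval_coef !mulr_suml.
rewrite !scaler_suml raddf_sum; apply: eq_bigr => i _.
have -> : (p`_i)%:~R * v ^+ i / v ^+ n = v ^ (i%:Z - n%:Z) *~ p`_i.
  by rewrite -mulrA mulrzl; congr (_ *~ _); rewrite (exprzDr v_unit) -exprnN.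
have -> : (p`_i)%:~R * v^-1 ^+ i * v ^+ n = v ^ (- (i%:Z - n%:Z)) *~ p`_i.
  rewrite -mulrA mulrzl opprB (exprzDr v_unit) -exprnN exprVn mulrC.
  by [].
by rewrite -!scalerMzl raddfMz mxbarE.
Qed.

Lemma mxbar_linear (a : Av) X Y : span X ->
  mxbar MX (a *: X + Y) = vbar a *: mxbar MX X + mxbar MX Y.
Proof.
move=> /span_expand[r [_ _ ->]]; rewrite raddfD; congr (_ + _).
rewrite !raddf_sum; apply: eq_bigr => y _.
by rewrite /= stdE !scalerA !mxbar_mj !rmorphM !scalerA mulrA.
Qed.

Lemma mxbarZ (a : Av) X : span X -> mxbar MX (a *: X) = vbar a *: mxbar MX X.
Proof. by move=> sX; rewrite -[a *: X]addr0 mxbar_linear // raddf0 addr0. Qed.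

(** The quadratic relation reads T_s^2 + T_s = u^2 (T_s + 1), so the right-hand side is a two-sided
    inverse of T_s. *)
Lemma hbar_simple s : simple s ->
  hbar H (hT H s) = (u^-1) ^+ 2 *: (hT H s + 1) - 1.
Proof.
move=> sS; have uU : u \is a GRing.unit by exact: lgen_unit.
have := hbarE H 0 s; rewrite oppr0 expr0z !scale1r simpleV // => ->.
set T := hT H s; have := hT_quad H sS; rewrite -/T => quad.
have TT : T * T + T = u ^+ 2 *: T + u ^+ 2 *: 1.
  move: quad; rewrite mulrDl mul1r mulrBr mulr_algr addrACA -opprD.
  by move/eqP; rewrite subr_eq0 => /eqP.
have uuK (h : H) : u^-1 ^+ 2 *: (u ^+ 2 *: h) = h.
  by rewrite scalerA exprVn mulVr ?unitrX // scale1r.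
set y := (X in _ = X).
have Ty : T * y = 1.
  by rewrite mulrBr mulr1 -scalerAr mulrDr mulr1 TT scalerDr !uuK addrC addKr.
have yT : y * T = 1.
  by rewrite mulrBl mul1r -scalerAl mulrDl mul1r TT scalerDr !uuK addrC addKr.
have TU : T \is a GRing.unit by apply/unitrP; exists y.
by rewrite -[LHS]mulr1 -Ty mulKr.
Qed.

(** The bar of T_s + 1 is u^-2 (T_s + 1), hence c_s is bar invariant. *)
Lemma mxbar_cact s X : simple s -> span X ->
  mxbar MX (cact s X) = cact s (mxbar MX X).
Proof.
move=> sS; elim/span_ind: X / => [a X Y sX sY eX eY||z zI].
- by rewrite linearP !mxbar_linear ?linearP ?eX ?eY //; exact: span_cact.
- by rewrite linear0 !raddf0.
rewrite stdE linearZ /= cact_mj scalerA !mxbar_mj linearZ /= cact_mj scalerA.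
have actP := mactP M.
rewrite raddfD /= mbarM hbar_simple //.
set m := mbar M (ma M z).
have -> : mact (u^-1 ^+ 2 *: (hT H s + 1) - 1) m =
    u^-1 ^+ 2 *: (mact (hT H s) m + m) - m.
  have lin := act_linear_l actP m.
  rewrite lin; congr (_ + _).
    by congr (_ *: _); have := lin 1 (hT H s) 1; rewrite !scale1r (act_one actP).
  have e0 := lin (-1) 0 0; rewrite scaler0 addr0 scaleN1r addNr in e0.
  by have := lin (-1) 1 0; rewrite /= e0 !addr0 !scaleN1r (act_one actP).
rewrite subrK linearZ /= scalerA rmorphM rmorphXn /= vbarV; congr (_ *: _).
by rewrite rmorphXn rmorphV ?lgen_unit //= vV2; have := vVK => e; ring: e.
Qed.

Variable P : W -> W -> {poly int}.
Hypothesis HP : is_Psigma MX P.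
Local Notation Aelt := (Aelt MX P).

Local Notation lower w := [set y | Istar st y /\ bruhat_le y w].

Lemma lower_fin w : finite_set (lower w).
Proof. by apply: sub_finite_set (bruhat_finite w) => y []. Qed.

Lemma lowerP y w : y \in fset_set (lower w) -> Istar st y /\ bruhat_le y w.
Proof. by rewrite (in_fset_set (lower_fin w)) in_setE. Qed.

Lemma Aelt_std w : Aelt w =
  \sum_(y <- fset_set (lower w)) pi_ P y w *: std y.
Proof.
rewrite /Aelt fsbig_finite ?scaler_sumr; last exact: lower_fin.
apply: eq_big_seq => y /lowerP[yI yw].
rewrite mj_std /pi_ asboolT // (exprzDr v_unit) !scalerA.
by congr (_ *: _); rewrite mulrA mulrAC.
Qed.

Lemma span_Aelt w : span (Aelt w).
Proof.
rewrite Aelt_std; apply: span_sum => y /lowerP[yI _].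
by apply: spanZ; exact: span_std.
Qed.

Lemma std_coord_Aelt y w : Istar st y -> Istar st w ->
  std_coord y (Aelt w) = pi_ P y w.
Proof.
move=> yI wI; rewrite Aelt_std std_coord_sum; set r := fset_set _.
have rI z : z \in r -> Istar st z by move=> /lowerP[].
transitivity (\sum_(z <- r) (z == y)%:R *: (pi_ P z w : Av^o)).
  apply: eq_big_seq => z /rI zI; rewrite std_coordZ std_coord_std //.
  by rewrite mulrC.
have [yr|yr] := boolP (y \in r); first by rewrite sum_delta ?fset_uniq.
rewrite pi_out; last first.
  move=> yw; move/negP: yr; apply.
  by rewrite (in_fset_set (lower_fin w)) in_setE.
rewrite big_seq big1 // => z zr; case: eqP yr => [<-|_ _]; first by rewrite zr.
by rewrite scale0r.
Qed.

End BarInvariance.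

Section CanonicalBasis.
Variables (W : coxeterSystem) (st : diagramInvolution W) (H : heckeAlgebra W).
Variables (M : involutionModule st H) (HX : heckeExtension H).
Variable MX : moduleExtension M HX.
Variable P : W -> W -> {poly int}.
Hypothesis HP : is_Psigma MX P.
Implicit Types (s y z w : W) (X Y : MX).
Local Notation std := (std MX).
Local Notation span := (@istar_span _ _ _ _ _ MX).
Local Notation Aelt := (Aelt MX P).
Local Notation lower w := [set y | Istar st y /\ bruhat_le y w].
Let P_diag := Psigma_diag HP.
Let P_deg := Psigma_deg HP.

(** Induction on len z, comparing coordinates at y in the bar invariance of A_z. Its terms with x <
    z contribute nothing by induction, and its leading coefficient is 1. *)
Lemma std_coord_mxbar_std y z : Istar st y -> Istar st z ->
  (len z <= len y)%N -> std_coord y (mxbar MX (std z)) = (z == y)%:R.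
Proof.
have [n] := ubnP (len z); elim: n z => // n IH z ltn yI zI le.
have zr : z \in fset_set (lower z).
  by rewrite (in_fset_set (lower_fin st z)) in_setE; split=> //; exact: bruhat_refl.
have := Psigma_bar HP zI => /(congr1 (std_coord y)).
rewrite (std_coord_Aelt MX P yI zI) Aelt_std raddf_sum std_coord_sum.
rewrite (big_rem z) //= big_seq big1 => [|x]; last first.
  rewrite mem_rem_uniq ?fset_uniq // inE => /andP[xz /lowerP[xI xz']].
  have ltx : (len x < len z)%N by apply: bruhat_ltP; split=> //; apply/eqP.
  rewrite mxbarZ ?std_coordZ; last exact: span_std.
  rewrite IH //; last exact: leq_trans (ltnW ltx) le.
    by case: eqP => [xy|]; rewrite ?mulr0 //; move: le; rewrite -xy leqNgt ltx.
  exact: leq_trans ltx _.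
rewrite addr0 mxbarZ; last exact: span_std.
rewrite std_coordZ (pi_diag P_diag zI) rmorph1 mul1r => ->.
have [->|zy] := eqVneq z y; first by rewrite (pi_diag P_diag).
apply: pi_out => /bruhat_le_len[lt|yz]; first by move: lt; rewrite ltnNge le.
by rewrite yz eqxx in zy.
Qed.

(* Unitriangularity makes the bar involution act on leading coordinates by
   [vbar]. *)
Lemma std_coord_mxbar X y : span X -> Istar st y ->
  (forall z, Istar st z -> (len y < len z)%N -> std_coord z X = 0) ->
  std_coord y (mxbar MX X) = vbar (std_coord y X).
Proof.
move=> sX yI top; have [r [_ rI XE]] := span_expand sX.
rewrite {1}XE [in RHS]XE raddf_sum !std_coord_sum rmorph_sum /=.
apply: eq_big_seq => z /rI zI; have sz := span_std MX zI.
rewrite mxbarZ // !std_coordZ rmorphM std_coord_std //=.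
have [le|lt] := leqP (len z) (len y).
  by rewrite std_coord_mxbar_std // rmorph_nat.
by rewrite (top z) // rmorph0 !mul0r.
Qed.

(** Descending induction on length, starting above the finite support. The vanishing need only be
    checked where all longer coordinates are already 0, and there the coordinate is fixed by
    [vbar]. *)
Lemma span_eq0 X : span X -> mxbar MX X = X ->
  (forall y, Istar st y ->
    (forall z, Istar st z -> (len y < len z)%N -> std_coord z X = 0) ->
    vbar (std_coord y X) = std_coord y X -> std_coord y X = 0) -> X = 0.
Proof.
move=> sX barX X0; have [r [_ rI XE]] := span_expand sX.
pose L := (\max_(y <- r) len y)%N.
suff H0 n y : Istar st y -> (L < len y + n)%N -> std_coord y X = 0.
  rewrite XE big_seq big1 // => y yr.
  have lt : (L < len y + L.+1)%N by rewrite addnS ltnS leq_addl.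
  by rewrite (H0 L.+1 y (rI _ yr) lt) scale0r.
elim: n y => [|n IH] y yI.
  rewrite addn0 => ltL; rewrite XE std_coord_sum big_seq big1 // => z zr.
  have zI := rI _ zr; rewrite std_coordZ std_coord_std //.
  case: eqP => [zy|]; rewrite ?mulr0 //.
  by move: ltL; rewrite ltnNge -zy (leq_bigmax_seq z zr).
move=> lt; have top z : Istar st z -> (len y < len z)%N -> std_coord z X = 0.
  by move=> zI ltz; apply: IH => //; lia.
by apply: X0 => //; rewrite -std_coord_mxbar // barX.
Qed.

(** * Eigenvectors of c_s for the eigenvalue u + u^-1 *)

Section Eigen.
Variables (s : W) (sS : simple s).
Local Notation up z := (len z < len (s * z)%g)%N.
Local Notation comm z := (s * z == z * st s)%g.
Local Notation tw := (twist st s).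

Lemma up_twist z : Istar st z -> up (tw z) = ~~ up z.
Proof.
move=> zI; have stS := star_simple st sS.
have [cm|/eqP cm] := eqVneq (s * z)%g (z * st s)%g.
  by rewrite twist_comm // simpleK //; have := len_simple z sS; lia.
rewrite twist_ncomm //; have -> : (s * (s * z * st s))%g = (z * st s)%g.
  by rewrite !mulgA simple_sqr // mul1g.
rewrite (len_mul_star sS zI); have [lt|ge] := boolP (up z).
  by rewrite (len_twist_up sS zI cm lt) (len_up sS lt) ltnNge leqnSn.
have lt : (len (s * z)%g < len z)%N by rewrite (len_down sS ge).
have := len_twist_down sS zI cm lt; rewrite (len_down sS ge) => -[<-].
by rewrite ltnSn.
Qed.

Lemma len_twist z : Istar st z -> up z -> (len z < len (tw z))%N.
Proof.
move=> zI lt; have [cm|/eqP cm] := eqVneq (s * z)%g (z * st s)%g.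
  by rewrite twist_comm.
by rewrite twist_ncomm // (len_twist_up sS zI cm lt) ltnS leqnSn.
Qed.

(** This is u + u^-1 written in v. *)
Definition eig_coef : Av := v ^+ 2 + v^-1 ^+ 2.
(* For [up z], an eigenvector has coordinate [desc z] times the one at [tw z]. *)
Definition desc z : Av := if comm z then v^-1 else v^-1 ^+ 2.

(** From (T_s + 1)^2 = (u^2 + 1)(T_s + 1): the whole image of c_s consists of eigenvectors. *)
Lemma cact_cact X : cact s (cact s X) = eig_coef *: cact s X.
Proof.
have actX := mxactP MX; rewrite /cact -(act_mul actX).
have scal (a : Av) (h : HX) : mxact (a *: h) X = a *: mxact h X.
  have lin := act_linear_l actX X.
  have e0 := lin (-1) 0 0; rewrite /= scaler0 addr0 scaleN1r addNr in e0.
  by have := lin a h 0; rewrite /= e0 !addr0.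
rewrite -scal; congr (mxact _ X); rewrite /c_ -scalerAl -scalerAr.
have quad : (hj HX (hT H s) + 1) * (hj HX (hT H s) + 1) =
    (v ^+ 4 + 1) *: (hj HX (hT H s) + 1).
  have := congr1 (hj HX) (hT_quad H sS).
  rewrite rmorphM rmorph0 rmorphD rmorphB rmorph1 /= linearZ /= rmorph1.
  rewrite rmorphXn /= incl_u -exprM; set T := hj HX _ => q.
  transitivity ((T + 1) * (T - (v ^+ 4)%:A) + (v ^+ 4 + 1) *: (T + 1)).
    rewrite -[X in _ = _ + X]mulr_algr -mulrDr; congr (_ * _).
    by rewrite scalerDl scale1r addrA subrK.
  by rewrite q add0r.
rewrite quad !scalerA; congr (_ *: _); rewrite vV2 /eig_coef.
by have e := vVK; ring: e.
Qed.

(** On the pair y, s o y the operator c_s - (u + u^-1) has rank one. Here and in [std_coord_eig_up]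
    the same difference appears: the coordinate at the shorter element minus [desc] times that at
    the longer. *)
Lemma std_coord_eig_down X y : Istar st y -> span X -> ~~ up y ->
  std_coord y (cact s X - eig_coef *: X) =
  twist_coef st s (tw y) * (std_coord (tw y) X - desc (tw y) * std_coord y X).
Proof.
move=> yI sX dn; have eV := vVK.
rewrite std_coordB std_coordZ std_coord_cact //.
rewrite /diag_coef /twist_coef /desc twist_eq_comm // up_twist // dn (negbTE dn).
rewrite /eig_coef.
by case: ifP => _; ring: eV.
Qed.

Lemma std_coord_eig_up X y : Istar st y -> span X -> up y ->
  exists c, std_coord y (cact s X - eig_coef *: X) =
    c * (std_coord y X - desc y * std_coord (tw y) X).
Proof.
move=> yI sX lt; have eV := vVK.
rewrite std_coordB std_coordZ std_coord_cact //.
rewrite /diag_coef /twist_coef /desc twist_eq_comm // up_twist // lt /= /eig_coef.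
(* The witnesses are [diag_coef st s y - eig_coef]. *)
case: ifP => _; [exists (1 - v ^+ 2)|exists (- v ^+ 2)]; ring: eV.
Qed.

Lemma twist_coef_neq0 z : up z -> twist_coef st s z != 0.
Proof.
by rewrite /twist_coef => ->; case: ifP => _; [exact: v2_neq0|exact: oner_neq0].
Qed.

Lemma twist_coef_bar z : up z -> vbar (twist_coef st s z) = twist_coef st s z.
Proof.
rewrite /twist_coef => ->; case: ifP; rewrite ?rmorph1 // => _.
by rewrite rmorphD /= vbarV vbar_v addrC.
Qed.

Lemma vneg_desc z f : vneg 0 f -> vneg 1 (desc z * f).
Proof.
move=> nf; rewrite /desc; case: ifP => _; first exact: vneg_mulV.
by apply: vnegS; rewrite expr2 -mulrA; do 2 apply: vneg_mulV.
Qed.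

Lemma eig_bar : vbar eig_coef = eig_coef.
Proof. by rewrite rmorphD !rmorphXn /= vbarV vbar_v addrC. Qed.

Lemma Aelt_eigen w : Istar st w -> ~~ up w ->
  cact s (Aelt w) = eig_coef *: Aelt w.
Proof.
move=> wI dnw; have sA := span_Aelt MX P w; have barA := Psigma_bar HP wI.
apply/eqP; rewrite -subr_eq0; apply/eqP; apply: span_eq0.
- by apply: spanB; [exact: span_cact|exact: spanZ].
- by rewrite raddfB /= (mxbar_cact sS sA) (mxbarZ _ sA) barA eig_bar.
move=> y yI top; have tI := twist_Istar sS yI.
have [lt|dn] := boolP (up y).
  (* The longer element [tw y] has coordinate 0 by [top], which kills the difference shared by the
     pair. *)
  move=> _; have [c ->] := std_coord_eig_up yI sA lt.
  have dnt : ~~ up (tw y) by rewrite up_twist // lt.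
  have := top _ tI (len_twist yI lt); rewrite std_coord_eig_down //.
  rewrite twistK // => /eqP; rewrite mulf_eq0 (negbTE (twist_coef_neq0 lt)) /=.
  by move=> /eqP ->; rewrite mulr0.
have ltt : up (tw y) by rewrite up_twist.
rewrite std_coord_eig_down // rmorphM /= twist_coef_bar //.
move=> /(mulfI (twist_coef_neq0 ltt)).
rewrite !std_coord_Aelt // => e; rewrite (vneg_bar_eq0 _ e) ?mulr0 //.
(* No constant term arises, since s lengthens [tw y] but not [w]. *)
apply: vnegB; first apply: (pi_vneg1 P_diag P_deg tI wI) => tyw.
  by move: dnw; rewrite -tyw ltt.
exact: vneg_desc (pi_vneg0 P_diag P_deg yI wI).
Qed.

End Eigen.
End CanonicalBasis.

(** * Multiplication formula *)

Lemma epsilon_odd (W : coxeterSystem) (y w : W) :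
  (epsilon y == epsilon w) = (odd (len y) == odd (len w)).
Proof.
by rewrite /epsilon -[_ ^+ len y]signr_odd -[_ ^+ len w]signr_odd; do 2 case: odd.
Qed.

Section Multiplication.
Variables (W : coxeterSystem) (st : diagramInvolution W) (H : heckeAlgebra W).
Variables (M : involutionModule st H) (HX : heckeExtension H).
Variable MX : moduleExtension M HX.
Variable P : W -> W -> {poly int}.
Hypothesis HP : is_Psigma MX P.
Variables mu1 mu2 : W -> W -> int.
Hypothesis Hmu : is_mu st P mu1 mu2.
Local Notation std := (std MX).
Local Notation span := (@istar_span _ _ _ _ _ MX).
Local Notation Aelt := (Aelt MX P).
Let P_diag := Psigma_diag HP.
Let P_deg := Psigma_deg HP.

Let mu0 (y z : W) : Istar st y -> Istar st z -> ~ bruhat_lt y z ->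
  mu1 y z = 0 /\ mu2 y z = 0.
Proof. exact: (mu_out P_diag P_deg Hmu). Qed.
Let mu1_odd (y z : W) : Istar st y -> Istar st z ->
  odd (len y) = odd (len z) -> mu1 y z = 0.
Proof. exact: (mu1_parity P_diag P_deg Hmu). Qed.
Let mu2_odd (y z : W) : Istar st y -> Istar st z ->
  odd (len y) != odd (len z) -> mu2 y z = 0.
Proof. exact: (mu2_parity P_diag P_deg Hmu). Qed.

Lemma pi_eqmod (y z : W) : Istar st y -> Istar st z ->
  vneg 1 (pi_ P y z - (y == z)%:R).
Proof.
move=> yI zI; have [->|/eqP yz] := eqVneq y z.
  by rewrite (pi_diag P_diag) // subrr; exact: vneg0.
by rewrite subr0; exact: (pi_vneg1 P_diag P_deg).
Qed.

(** For the factor v^2 in [diag_coef]; the next lemma serves the factor v + v^-1 in [twist_coef]. *)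
Lemma v2pi_eqmod (y z : W) : Istar st y -> Istar st z -> y <> z ->
  vneg 1 (v ^+ 2 * pi_ P y z - ((mu1 y z)%:~R * v + (mu2 y z)%:~R)).
Proof.
move=> yI zI /eqP/negbTE yz; have := mu_pi Hmu yI zI; rewrite yz add0r.
set n := (X in vneg 3 X) => n3.
have -> : v ^+ 2 * pi_ P y z - ((mu1 y z)%:~R * v + (mu2 y z)%:~R) = v * (v * n).
  by have e := vVK; rewrite /n -!exprVn; ring: e.
by do 2 apply: vneg_mulv.
Qed.

Lemma vvpi_eqmod (y z : W) : Istar st y -> Istar st z ->
  vneg 1 ((v + v^-1) * pi_ P y z - ((y == z)%:R * v + (mu1 y z)%:~R)).
Proof.
move=> yI zI; have := mu_pi Hmu yI zI.
set n := (X in vneg 3 X) => n3.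
set d : Av := (y == z)%:R.
have -> : (v + v^-1) * pi_ P y z - (d * v + (mu1 y z)%:~R) =
    v * n + (v^-1 * n + (v^-1 * d + (v^-1 * (mu2 y z)%:~R +
      (v^-1 * (v^-1 * (mu1 y z)%:~R) + v^-1 * (v^-1 * (v^-1 * (mu2 y z)%:~R)))))).
  by have e := vVK; rewrite /n -!exprVn -/d; ring: e.
have nd : vneg 0 d by rewrite /d -[_%:R]/((y == z)%:Z%:~R); exact: vneg_int.
have i0 (a : int) := vneg_int a.
apply: vnegD; first exact/vnegS/vneg_mulv.
apply: vnegD; first by do 3 apply: vnegS; exact: vneg_mulV.
apply: vnegD; first exact: vneg_mulV.
apply: vnegD; first exact: vneg_mulV.
apply: vnegD; first by apply: vnegS; do 2 apply: vneg_mulV.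
by do 2 apply: vnegS; do 3 apply: vneg_mulV.
Qed.

(** * The case sw > w: the defect of the multiplication formula *)

Variables (s w : W).
Hypotheses (sS : simple s) (wI : Istar st w).
Local Notation up z := (len z < len (s * z)%g)%N.
Local Notation comm z := (s * z == z * st s)%g.
Local Notation tw := (twist st s).
Hypothesis upw : up w.
Local Notation Mc z := (Mcoef st mu1 mu2 s z w).
Local Notation tgt := (tw w).
Let tI : Istar st tgt := twist_Istar sS wI.

(** With the target s o w, the index sets of (a) and (b) become a single one. *)
Definition mu_range : set W :=
  [set z | [/\ Istar st z, bruhat_lt (s * z)%g z & bruhat_lt z tgt]].
Definition mu_between (y : W) : set W :=
  [set x | [/\ Istar st x, bruhat_lt y x, bruhat_lt x w & bruhat_lt (s * x)%g x]].
Definition mu_sum (y : W) : int :=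
  \sum_(x \in mu_between y) mu1 y x * mu1 x w.

Lemma mu_range_fin : finite_set mu_range.
Proof. by apply: sub_finite_set (bruhat_finite tgt) => z [_ _ []]. Qed.

Lemma down_bruhat z : ~~ up z <-> bruhat_lt (s * z)%g z.
Proof.
rewrite bruhat_gt_simple //; split; last by rewrite -leqNgt; exact: ltnW.
by move=> dn; rewrite (len_down sS dn).
Qed.

Lemma sw_le_tgt : bruhat_le (s * w)%g tgt.
Proof.
have [cm|/eqP cm] := eqVneq (s * w)%g (w * st s)%g.
  by rewrite twist_comm //; exact: bruhat_refl.
rewrite twist_ncomm //; have stR := simple_reflection (star_simple st sS).
apply: bruhat_step stR _; first exact: bruhat_refl.
by rewrite (len_twist_up sS wI cm upw) (len_up sS upw).
Qed.

Lemma w_le_tgt : bruhat_le w tgt.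
Proof.
by apply: bruhat_le_trans sw_le_tgt; case/(bruhat_lt_simple _ sS): upw.
Qed.

Lemma bruhat_lt_tgt z : bruhat_le z w -> bruhat_lt z tgt.
Proof.
move=> zw; split; first exact: bruhat_le_trans zw w_le_tgt.
move=> zt; have := len_twist sS wI upw; rewrite -zt ltnNge.
by case: (bruhat_le_len zw) => [/ltnW|] ->; rewrite ?leqnn.
Qed.

Lemma mu_sum_out y : ~ bruhat_lt y w -> mu_sum y = 0.
Proof.
move=> yw; apply: fsbig1 => x [_ [yx _] xw _]; case: yw; split.
  exact: bruhat_le_trans yx xw.1.
move=> yE; have := bruhat_ltP xw; rewrite ltnNge -yE.
by case: (bruhat_le_len yx) => [/ltnW|] ->; rewrite ?leqnn.
Qed.

(** None of z < w, z < sw (in the commuting case) and sz < w can hold, so every mu in the formula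
    vanishes. Hence [Mcoef] at y can be viewed as a term of the sum over [mu_range]. *)
Lemma Mcoef_out z : Istar st z -> ~~ up z -> ~ bruhat_lt z tgt -> Mc z = 0.
Proof.
move=> zI dn zt.
have zw : ~ bruhat_lt z w by move=> [zw _]; apply: zt; exact: bruhat_lt_tgt.
rewrite /Mcoef -/(mu_between z) -/(mu_sum z) mu_sum_out //.
have [-> ->] := mu0 zI wI zw.
case: ifP => _; last by rewrite mul0r.
have -> : (comm w)%:R * mu1 z (s * w)%g = 0.
  case: eqP => cm; last by rewrite mul0r.
  by rewrite -(twist_comm cm); have [-> _] := mu0 zI tI zt; rewrite mulr0.
have -> : mu1 (s * z)%g w * (comm z)%:R = 0.
  case: eqP => cm; last by rewrite mulr0.
  have szI : Istar st (s * z)%g by rewrite -(twist_comm cm); exact: twist_Istar.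
  suff nlt : ~ bruhat_lt (s * z)%g w.
    by have [-> _] := mu0 szI wI nlt; rewrite mul0r.
  move=> lt; have ltsz := bruhat_ltP lt.
  (* Lifting sz < w gives z below w or below sw. *)
  have [] := bruhat_mul_simple sS lt.1; rewrite simpleK // => le.
    by apply: zt; exact: bruhat_lt_tgt.
  apply: zt; split; first exact: bruhat_le_trans le sw_le_tgt.
  move=> zE; have := len_twist sS wI upw; rewrite -zE (len_down sS dn).
  by rewrite ltnS leqNgt ltsz.
by rewrite subr0 subr0 addr0.
Qed.

Lemma Mcoef_bar z : vbar (Mc z) = Mc z.
Proof.
rewrite /Mcoef; case: ifP => _; first by rewrite rmorph_int.
by rewrite rmorphM rmorph_int rmorphD /= vbarV vbar_v [v^-1 + v]addrC.
Qed.

(** The added terms vanish because mu' is 0 off the Bruhat order. *)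
Lemma mu_sum_range y : Istar st y ->
  mu_sum y = \sum_(x <- fset_set mu_range) mu1 y x * mu1 x w.
Proof.
move=> yI; rewrite -(fsbig_finite _ _ mu_range_fin); apply: fsbig_widen.
  by move=> x [xI yx xw sx]; split=> //; exact: bruhat_lt_tgt xw.1.
move=> x [[xI sx xt] /= nx].
have [yx|yx] := pselect (bruhat_lt y x); last first.
  by have [-> _] := mu0 yI xI yx; rewrite mul0r.
have [xw|xw] := pselect (bruhat_lt x w); last first.
  by have [-> _] := mu0 xI wI xw; rewrite mulr0.
by case: nx.
Qed.

Lemma mu_rangeP z : z \in fset_set mu_range ->
  [/\ Istar st z, ~~ up z & bruhat_lt z tgt].
Proof.
rewrite (in_fset_set mu_range_fin) in_setE => -[zI sz zt]; split=> //.
exact/down_bruhat.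
Qed.

(** The term z = y gives [Mcoef] at y. For z other than y with the sign of w, the coefficient is an
    integer and pi lies in v^-1 Z[v^-1]. For opposite signs the factor v + v^-1 leaves mu'_(y,z)
    mu'_(z,w), which is 0 unless y and w have equal signs: hence the sum in the definition of
    M^s. *)
Lemma range_sum_eqmod y : Istar st y -> ~~ up y ->
  vneg 1 (\sum_(z <- fset_set mu_range) Mc z * pi_ P y z
    - (Mc y + (epsilon y == epsilon w)%:R * (mu_sum y)%:~R)).
Proof.
move=> yI dny; set r := fset_set mu_range.
have -> : Mc y = \sum_(z <- r) (z == y)%:R * Mc z.
  have [yr|yr] := boolP (y \in r).
    by rewrite -[LHS](sum_delta (fun z => Mc z : Av^o) (fset_uniq r) yr).
  rewrite Mcoef_out //; last first.
    move=> yt; move/negP: yr; apply; rewrite (in_fset_set mu_range_fin) in_setE.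
    by split=> //; exact/down_bruhat.
  rewrite big_seq big1 // => z zr; case: eqP => [zy|]; last by rewrite mul0r.
  by rewrite -zy zr in yr.
rewrite mu_sum_range // rmorph_sum /= mulr_sumr -big_split -sumrB /=.
apply: vneg_sum => z /mu_rangeP[zI dnz zt].
have [->|/eqP zy] := eqVneq z y.
  rewrite (pi_diag P_diag) // mulr1 mul1r mu1_odd // mul0r mulr0 addr0 subrr.
  exact: vneg0.
have pi1 : vneg 1 (pi_ P y z) by apply: (pi_vneg1 P_diag P_deg) => // /esym.
rewrite mul0r add0r rmorphM /= epsilon_odd.
rewrite /Mcoef epsilon_odd; case: ifP => [/eqP ezw|ezw].
  rewrite (mu1_odd zI wI ezw) !mulr0 subr0.
  exact: vneg_intM.
have := vvpi_eqmod yI zI; have /negbTE -> : y != z by apply/eqP => /esym.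
rewrite mul0r add0r; set c := (mu1 z w)%:~R => vv.
have -> : c * (v + v^-1) * pi_ P y z -
    (odd (len y) == odd (len w))%:R * ((mu1 y z)%:~R * c) =
    c * ((v + v^-1) * pi_ P y z - (mu1 y z)%:~R).
  case: eqP => [_|eyw]; first by rewrite mul1r; ring.
  have -> : mu1 y z = 0.
    by apply: mu1_odd => //; move: ezw eyw; do 3 case: odd.
  by rewrite !mul0r; ring.
exact: vneg_intM.
Qed.

Definition mult_defect : MX := cact s (Aelt w) -
  (twist_coef st s w *: Aelt tgt + \sum_(z <- fset_set mu_range) Mc z *: Aelt z).

(** This calculation dictates the form of [Mcoef]: the nonnegative powers of v cancel among the
    three parts of the defect. *)
Lemma defect_eqmod y : Istar st y -> ~~ up y ->
  vneg 1 (std_coord y mult_defect).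
Proof.
move=> yI dny; have yI' := twist_Istar sS yI.
have yw : y <> w by move=> yw; move: dny; rewrite yw upw.
rewrite /mult_defect std_coordB std_coordD std_coordZ std_coord_sum.
rewrite std_coord_cact //; last exact: span_Aelt.
rewrite !(std_coord_Aelt MX P _ wI) // (std_coord_Aelt MX P yI tI).
have -> : \sum_(z <- fset_set mu_range) std_coord y (Mc z *: Aelt z) =
    \sum_(z <- fset_set mu_range) Mc z * pi_ P y z.
  apply: eq_big_seq => z /mu_rangeP[zI _ _].
  by rewrite std_coordZ std_coord_Aelt.
have := range_sum_eqmod yI dny; move: (\sum_(z <- _) _) => S.
have tyw : (tw y == w) = (y == tgt).
  by apply/eqP/eqP => [<-|->]; rewrite twistK.
have F1 := v2pi_eqmod yI wI yw.
have F1' := pi_eqmod yI wI; rewrite (negbTE (introN eqP yw)) subr0 in F1'.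
(* [E1] and [E2] are the coordinates at y of c_s A_w and of the target term, minus their terms in
   nonnegative powers of v. *)
pose E1 := diag_coef st s y * pi_ P y w + twist_coef st s (tw y) * pi_ P (tw y) w -
  ((mu1 y w)%:~R * v + (mu2 y w)%:~R +
   if comm y then (y == tgt)%:R * v + (mu1 (s * y)%g w)%:~R else (y == tgt)%:R).
have nE1 : vneg 1 E1.
  rewrite /E1 /diag_coef /twist_coef twist_eq_comm // up_twist // (negbTE dny) /=.
  case: ifP => [/eqP cm|_].
    have := vvpi_eqmod yI' wI; rewrite tyw twist_comm // => F2.
    have := vnegD (vnegB F1 F1') F2; congr vneg; ring.
  have := pi_eqmod yI' wI; rewrite tyw => F3.
  have := vnegD F1 F3; congr vneg; ring.
pose E2 := twist_coef st s w * pi_ P y tgt -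
  (if comm w then (y == tgt)%:R * v + (mu1 y (s * w)%g)%:~R else (y == tgt)%:R).
have nE2 : vneg 1 E2.
  rewrite /E2 /twist_coef upw; case: ifP => [/eqP cm|_].
    by have := vvpi_eqmod yI tI; rewrite {3}(twist_comm cm).
  by rewrite mul1r; exact: pi_eqmod.
(* Makes the terms with [y == tgt] in [E1] and [E2] agree, so they drop out of [R]. *)
have ct : y == tgt -> comm y = comm w by move=> /eqP ->; exact: twist_eq_comm.
move=> nE3; have := vnegB nE1 (vnegD nE2 nE3).
(* The remaining main terms. For equal signs they sum to 0 by definition of M^s; for opposite signs
   parity leaves only -mu'_(y,w) v^-1. *)
pose R := (mu1 y w)%:~R * v + (mu2 y w)%:~R +
  (if comm y then (mu1 (s * y)%g w)%:~R else 0) -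
  (if comm w then (mu1 y (s * w)%g)%:~R else 0) -
  (Mc y + (epsilon y == epsilon w)%:R * (mu_sum y)%:~R).
have nR : vneg 1 R.
  rewrite /R /Mcoef -/(mu_between y) -/(mu_sum y) epsilon_odd.
  have [eyw|odd2] := eqVneq (odd (len y)) (odd (len w)).
    rewrite mu1_odd // mul1r.
    rewrite !(rmorphD, rmorphN, rmorphM) /= !rmorph_nat mul0r.
    set X := (X in vneg 1 X); suff -> : X = 0 by exact: vneg0.
    by rewrite /X; case: (comm y); case: (comm w);
      rewrite ?mul1r ?mul0r ?mulr1 ?mulr0; ring.
  rewrite mu2_odd // mul0r.
  have -> : (if comm y then (mu1 (s * y)%g w)%:~R else 0) = 0 :> Av.
    case: eqP => // cm; rewrite mu1_odd // -(twist_comm cm) //.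
    move: odd2; rewrite twist_comm // (len_down sS dny) /=.
    by do 2 case: odd.
  have -> : (if comm w then (mu1 y (s * w)%g)%:~R else 0) = 0 :> Av.
    case: eqP => // cm; rewrite mu1_odd // -(twist_comm cm) //.
    by move: odd2; rewrite twist_comm // (len_up sS upw) /=; do 2 case: odd.
  set X := (X in vneg 1 X); have -> : X = - (v^-1 * (mu1 y w)%:~R).
    by rewrite /X; ring.
  by apply: vnegN; apply: vneg_mulV; exact: vneg_int.
move=> n1; have := vnegD n1 nR; congr vneg; rewrite /E1 /E2 /R.
have [yt|/negbTE yt] := boolP (y == tgt).
  by rewrite (ct yt); case: ifP => _; ring.
have f0 : false%:R = 0 :> Av by [].
by rewrite f0; case: (comm y); case: (comm w); ring.
Qed.

Lemma mult_defect_eq0 : mult_defect = 0.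
Proof.
have sA := span_Aelt MX P.
have sT : span (\sum_(z <- fset_set mu_range) Mc z *: Aelt z).
  by apply: span_sum => z _; exact: spanZ.
have sD : span mult_defect.
  apply: spanB; first exact: span_cact.
  by apply: spanD => //; exact: spanZ.
(* c_s A_w is an eigenvector as an image of c_s, the other terms because s shortens their
   indices. *)
have eD : cact s mult_defect = eig_coef *: mult_defect.
  rewrite /mult_defect scalerBr scalerDr scaler_sumr.
  rewrite linearB linearD /=.
  rewrite [cact s (\sum_(z <- _) _)]linear_sum /=.
  congr (_ - (_ + _)).
  - by rewrite cact_cact.
  - have dnt : ~~ up tgt by rewrite up_twist // upw.
    by rewrite linearZ /= (Aelt_eigen HP sS tI dnt) scalerA mulrC -scalerA.
  apply: eq_big_seq => z /mu_rangeP[zI dnz _].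
  by rewrite linearZ /= (Aelt_eigen HP sS zI dnz) scalerA mulrC -scalerA.
apply: (span_eq0 HP sD).
  rewrite /mult_defect raddfB raddfD /= (mxbar_cact sS (sA w)).
  rewrite (mxbarZ _ (sA tgt)) twist_coef_bar // !(Psigma_bar HP) // raddf_sum.
  congr (_ - (_ + _)); apply: eq_big_seq => z /mu_rangeP[zI _ _].
  by rewrite /= (mxbarZ _ (sA z)) Mcoef_bar (Psigma_bar HP).
move=> y yI top; have [upy|dny] := boolP (up y); last first.
  exact: vneg_bar_eq0 (defect_eqmod yI dny).
have ytI := twist_Istar sS yI.
have dnt : ~~ up (tw y) by rewrite up_twist // upy.
(* The eigenvector equation at [tw y] ties the coordinate at y to the one at the longer [tw y],
   already 0. *)
move=> _; have := std_coord_eig_down sS ytI sD dnt.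
rewrite eD subrr std_coord0 twistK // (top _ ytI (len_twist sS yI upy)) mulr0 subr0.
by move/esym/eqP; rewrite mulf_eq0 (negbTE (twist_coef_neq0 st upy)) => /eqP.
Qed.

Lemma cact_Aelt_up : cact s (Aelt w) =
  twist_coef st s w *: Aelt tgt + \sum_(z \in mu_range) Mc z *: Aelt z.
Proof.
rewrite (fsbig_finite _ _ mu_range_fin); apply/eqP.
by rewrite -subr_eq0 -/mult_defect mult_defect_eq0.
Qed.

End Multiplication.

Theorem theorem6p3
    (W : coxeterSystem) (st : diagramInvolution W)
    (H : heckeAlgebra W) (M : involutionModule st H)
    (HX : heckeExtension H) (MX : moduleExtension M HX)
    (P : W -> W -> {poly int}) (HP : is_Psigma MX P)
    (mu1 mu2 : W -> W -> int) (Hmu : is_mu st P mu1 mu2)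
    (s w : W) (Hs : simple s) (Hw : Istar st w) :
  [/\ (s * w = w * st s)%g -> bruhat_lt w (s * w)%g ->
        mxact (c_ HX s) (Aelt MX P w) =
          (v + v^-1) *: Aelt MX P (s * w)%g
          + \sum_(z \in [set z | [/\ Istar st z, bruhat_lt (s * z)%g z
                                   & bruhat_lt z (s * w)%g]])
              Mcoef st mu1 mu2 s z w *: Aelt MX P z,
      (s * w)%g <> (w * st s)%g -> bruhat_lt w (s * w)%g ->
        mxact (c_ HX s) (Aelt MX P w) =
          Aelt MX P (s * w * st s)%g
          + \sum_(z \in [set z | [/\ Istar st z, bruhat_lt (s * z)%g z
                                   & bruhat_lt z (s * w * st s)%g]])
              Mcoef st mu1 mu2 s z w *: Aelt MX P z
    & bruhat_lt (s * w)%g w ->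
        mxact (c_ HX s) (Aelt MX P w) =
          (inclA u + (inclA u)^-1) *: Aelt MX P w].
Proof.
split=> [cm /bruhat_ltP up|cm /bruhat_ltP up|/(down_bruhat Hs) dn].
- have := cact_Aelt_up HP Hmu Hs Hw up.
  by rewrite /mu_range /twist_coef cm eqxx -cm up (twist_comm cm).
- have := cact_Aelt_up HP Hmu Hs Hw up.
  by rewrite /mu_range /twist_coef (negbTE (introN eqP cm)) (twist_ncomm cm) scale1r.
by rewrite vV2 incl_u; exact: (Aelt_eigen HP Hs Hw dn).
Qed.
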